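(* Let $(N,\Sigma,\beta)$ be a stacky fan with $\beta:\mathbb{Z}^n\to N$, and let $\mathcal{X}(N,\Sigma,\beta)=[Z_\Sigma/G]$ be its corresponding toric Deligne-Mumford stack. Let $N_0=\mathrm{im}(\beta)\subset N$, let $\beta_0:\mathbb{Z}^n\to N_0$ be $\beta$ with its codomain restricted, and let $\Sigma_0$ be the fan in $N_0\otimes\mathbb{R}$ corresponding to $\Sigma$ under the natural isomorphism $N_0\otimes\mathbb{R}\cong N\otimes\mathbb{R}$ induced by the inclusion $N_0\subset N$. Then $(N_0,\Sigma_0,\beta_0)$ is a stacky fan, and its corresponding toric Deligne-Mumford stack is $\mathcal{X}(N_0,\Sigma_0,\beta_0)=[Z_\Sigma/G_0]$, where $G_0\subset G$ is the connected component of the identity element, acting on $Z_\Sigma$ by restriction of the $G$-action.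
   Context: Notation: $\mathbb{T}=\mathbb{C}^\times$; $(-)^\star=\mathrm{Hom}_{\mathbb{Z}}(-,\mathbb{Z})$; $e_1,\dots,e_n$ is the standard basis of $\mathbb{Z}^n$. A stacky fan $(N,\Sigma,\beta)$ consists of a finitely generated abelian group $N$ of rank $d$, a rational simplicial fan $\Sigma$ in $N\otimes\mathbb{R}$ with rays $\rho_1,\ldots,\rho_n$, and a homomorphism $\beta:\mathbb{Z}^n\to N$ such that the rays span $N\otimes\mathbb{R}$ and, for each $j$, $\beta(e_j)\otimes 1$ lies on (and generates) $\rho_j$. (In particular $\mathrm{coker}\,\beta$ is finite.) The toric Deligne-Mumford stack $\mathcal{X}(N,\Sigma,\beta)=[Z_\Sigma/G]$ (a quotient stack over smooth manifolds) is defined as follows. Let $J(\Sigma)\subset\mathbb{C}[z_1,\dots,z_n]$ be the ideal generated by the monomials $\prod_{\rho_i\not\subset\sigma}z_i$, $\sigma\in\Sigma$, and $Z_\Sigma=\mathbb{C}^n\smallsetminus V(J(\Sigma))$. Choose a free resolution $0\to\mathbb{Z}^\ell\xrightarrow{Q}\mathbb{Z}^{d+\ell}\to N\to 0$ and a lift $B:\mathbb{Z}^n\to\mathbb{Z}^{d+\ell}$ of $\beta$. Let $[B\,Q]:\mathbb{Z}^n\oplus\mathbb{Z}^\ell\to\mathbb{Z}^{d+\ell}$ be the map restricting to $B$ and $Q$, set $\mathrm{DG}(\beta)=(\mathbb{Z}^{n+\ell})^\star/\mathrm{im}\,[B\,Q]^\star$ (well defined up to natural isomorphism), and let $\beta^\vee:(\mathbb{Z}^n)^\star\to\mathrm{DG}(\beta)$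 be the inclusion into the first $n$ coordinates followed by the quotient map. Put $G=\mathrm{Hom}_{\mathbb{Z}}(\mathrm{DG}(\beta),\mathbb{T})$; it acts on $Z_\Sigma\subset\mathbb{C}^n$ through the homomorphism $G\to\mathbb{T}^n$ obtained by applying $\mathrm{Hom}_{\mathbb{Z}}(-,\mathbb{T})$ to $\beta^\vee$. *)

(* Defs.v *)
From HB Require Import structures.
From mathcomp Require Import all_boot all_order all_algebra.
From mathcomp Require Import complex.
From mathcomp Require Import all_classical all_reals all_analysis.
From mathcomp Require mpoly.
(* Only the ring structures of {mpoly C[n]}: the notations of mpoly clash with
   those of the analysis library. *)
Import (canonicals) mpoly.

Set Implicit Arguments.
Unset Strict Implicit.
Unset Printing Implicit Defensive.

Import Order.TTheory GRing.Theory Num.Theory.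
Import numFieldNormedType.Exports.

Local Open Scope classical_set_scope.
Local Open Scope quotient_scope.
Local Open Scope ring_scope.

(* The complex numbers; going through numClosedFieldType gives them the
   topology of the modulus. *)
Definition Cx (R : realType) : numClosedFieldType := complex R.

(** * Finitely generated abelian groups *)

Definition finitely_generated (N : zmodType) : Prop :=
  exists m (g : {additive 'rV[int]_m -> N}), range g = setT.

Definition zfree (N : zmodType) (k : nat) (x : 'I_k -> N) : Prop :=
  forall c : 'I_k -> int, \sum_i x i *~ c i = 0 -> forall i, c i = 0.

Definition has_rank (N : zmodType) (d : nat) : Prop :=
  (exists x : 'I_d -> N, zfree x) /\ (forall x : 'I_d.+1 -> N, ~ zfree x).

Section Image.
Variables (n : nat) (N : zmodType) (beta : {additive 'rV[int]_n -> N}).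

Definition im_pred : {pred N} := fun x => `[< range beta x >].

Fact im_pred_zmod : zmod_closed im_pred.
Proof.
split; first by apply/asboolP; exists 0; rewrite ?raddf0.
move=> x y /asboolP[v _ <-] /asboolP[w _ <-].
by apply/asboolP; exists (v - w); rewrite ?raddfB.
Qed.
HB.instance Definition _ := GRing.isZmodClosed.Build N im_pred im_pred_zmod.

(* N_0, as the subgroup im(beta) of N *)
Definition im_group := {x : N | x \in im_pred}.
HB.instance Definition _ := [isSub of im_group for @sval _ _].
HB.instance Definition _ := [Choice of im_group by <:].
HB.instance Definition _ := [SubChoice_isSubZmodule of im_group by <:].

Fact im_pred_beta v : beta v \in im_pred.
Proof. by apply/asboolP; exists v. Qed.

(* beta_0 *)
Definition corestrict (v : 'rV[int]_n) : im_group :=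
  exist _ (beta v) (im_pred_beta v).

Fact corestrict_zmod_morphism : zmod_morphism corestrict.
Proof. by move=> v w; apply/val_inj; rewrite raddfB /= raddfB. Qed.
HB.instance Definition _ :=
  GRing.isZmodMorphism.Build _ _ corestrict corestrict_zmod_morphism.
End Image.

(** * Extension of scalars N (x) R *)

(* An element is a class of formal sums [:: (x_1, a_1); ...; (x_r, a_r)]
   of x_i (x) a_i, two sums being identified when every biadditive map
   N x R -> W to an abelian group takes the same value on them. *)
Section Realification.
Variables (R : realType) (N : zmodType).

Definition biadditive (W : zmodType) (f : N -> R -> W) : Prop :=
  (forall x y a, f (x + y) a = f x a + f y a) /\
  (forall x a b, f x (a + b) = f x a + f x b).

Definition tsum (W : zmodType) (f : N -> R -> W) (s : seq (N * R)) : W :=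
  \sum_(p <- s) f p.1 p.2.

Definition tens_eq (s t : seq (N * R)) : bool :=
  `[< forall (W : zmodType) (f : N -> R -> W),
        biadditive f -> tsum f s = tsum f t >].

Fact tens_eq_equiv : equiv_class_of tens_eq.
Proof.
split=> [s|s t|t s u].
- by apply/asboolP.
- by apply/asboolP/asboolP => H W f bf; rewrite H.
- by move=> /asboolP H1 /asboolP H2; apply/asboolP => W f bf; rewrite H1 ?H2.
Qed.
Canonical tens_eq_equiv_rel := EquivRelPack tens_eq_equiv.

Definition realification := {eq_quot tens_eq}.
HB.instance Definition _ : EqQuotient _ tens_eq realification :=
  EqQuotient.on realification.
HB.instance Definition _ := Choice.on realification.

Implicit Types x y z : realification.

Definition tens_val (W : zmodType) (f : N -> R -> W) x : W := tsum f (repr x).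

Lemma tens_val_pi (W : zmodType) (f : N -> R -> W) s :
  biadditive f -> tens_val f (\pi_realification s) = tsum f s.
Proof.
move=> bf; have /eqquotP/asboolP := reprK (\pi_realification s).
exact.
Qed.

Lemma tens_val_inj x y :
  (forall (W : zmodType) (f : N -> R -> W),
     biadditive f -> tens_val f x = tens_val f y) -> x = y.
Proof. by move=> H; rewrite -[x]reprK -[y]reprK; apply/eqquotP/asboolP. Qed.

Definition tadd x y := \pi_realification (repr x ++ repr y).
Definition topp x := \pi_realification [seq (- p.1, p.2) | p <- repr x].
Definition tzero := \pi_realification [::].
Definition tscale (a : R) x := \pi_realification [seq (p.1, a * p.2) | p <- repr x].

Lemma biadditive_scale (W : zmodType) (f : N -> R -> W) (a : R) :
  biadditive f -> biadditive (fun (v : N) b => f v (a * b)).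
Proof. by case=> fD fd; split=> *; rewrite ?mulrDr ?fD ?fd. Qed.

Lemma tens_valD (W : zmodType) (f : N -> R -> W) x y :
  biadditive f -> tens_val f (tadd x y) = tens_val f x + tens_val f y.
Proof. by move=> bf; rewrite tens_val_pi// /tsum big_cat. Qed.

Lemma tens_valN (W : zmodType) (f : N -> R -> W) x :
  biadditive f -> tens_val f (topp x) = - tens_val f x.
Proof.
move=> bf; rewrite tens_val_pi// /tens_val /tsum big_map -sumrN; apply: eq_bigr => p _.
apply/eqP; rewrite -addr_eq0 /= -bf.1 addNr.
by apply/eqP/(@addrI _ (f 0 p.2)); rewrite addr0 -bf.1 addr0.
Qed.

Lemma tens_val0 (W : zmodType) (f : N -> R -> W) :
  biadditive f -> tens_val f tzero = 0.
Proof. by move=> bf; rewrite tens_val_pi// /tsum big_nil. Qed.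

Lemma tens_valZ (W : zmodType) (f : N -> R -> W) a x :
  biadditive f -> tens_val f (tscale a x) = tens_val (fun (v : N) b => f v (a * b)) x.
Proof. by move=> bf; rewrite tens_val_pi// /tsum big_map. Qed.

Fact taddA : associative tadd.
Proof. by move=> x y z; apply: tens_val_inj => W f bf; rewrite !tens_valD// addrA. Qed.
Fact taddC : commutative tadd.
Proof. by move=> x y; apply: tens_val_inj => W f bf; rewrite !tens_valD// addrC. Qed.
Fact tadd0 : left_id tzero tadd.
Proof. by move=> x; apply: tens_val_inj => W f bf; rewrite tens_valD// tens_val0// add0r. Qed.
Fact taddN : left_inverse tzero topp tadd.
Proof.
by move=> x; apply: tens_val_inj => W f bf; rewrite tens_valD// tens_valN// tens_val0// addNr.
Qed.
HB.instance Definition _ :=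
  GRing.isZmodule.Build realification taddA taddC tadd0 taddN.

Fact tscaleA a b x : tscale a (tscale b x) = tscale (a * b) x.
Proof.
apply: tens_val_inj => W f bf; have bf' := biadditive_scale.
rewrite !tens_valZ//; last exact: bf'.
by rewrite /tens_val /tsum; apply: eq_bigr => p _; rewrite mulrA.
Qed.
Fact tscale1 : left_id 1 tscale.
Proof.
move=> x; apply: tens_val_inj => W f bf; rewrite tens_valZ//.
by rewrite /tens_val /tsum; apply: eq_bigr => p _; rewrite mul1r.
Qed.
Fact tscaleDr : right_distributive tscale +%R.
Proof.
move=> a x y; apply: tens_val_inj => W f bf.
by rewrite tens_valD// !tens_valZ// tens_valD//; exact: biadditive_scale.
Qed.
Fact tscaleDl x : {morph tscale^~ x : a b / a + b}.
Proof.
move=> a b; apply: tens_val_inj => W f bf; rewrite tens_valD// !tens_valZ//.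
rewrite /tens_val /tsum -big_split; apply: eq_bigr => p _.
by rewrite /= mulrDl bf.2.
Qed.
HB.instance Definition _ :=
  GRing.Zmodule_isLmodule.Build R realification tscaleA tscale1 tscaleDr tscaleDl.

(* x |-> x (x) 1 *)
Definition to_real (x : N) : realification := \pi_realification [:: (x, 1)].

End Realification.
Arguments to_real {R N} x.

(* h (x) id_R for h : N -> N' *)
Definition realification_map (R : realType) (N N' : zmodType)
    (h : {additive N -> N'}) (x : realification R N) : realification R N' :=
  \pi_(realification R N') [seq (h p.1, p.2) | p <- repr x].

(** * Fans *)

Section Cones.
Variables (R : realType) (V : lmodType R).

Definition rfree (k : nat) (v : 'I_k -> V) : Prop :=
  forall c : 'I_k -> R, \sum_i c i *: v i = 0 -> forall i, c i = 0.

Definition conic_hull (k : nat) (v : 'I_k -> V) : set V :=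
  [set x | exists2 a : 'I_k -> R, (forall i, 0 <= a i) & x = \sum_i a i *: v i].

Definition lin_span (A : set V) : set V :=
  [set x | exists k (c : 'I_k -> R) (v : 'I_k -> V),
      (forall i, A (v i)) /\ x = \sum_i c i *: v i].

Definition half_line (v : V) : set V :=
  [set x | exists2 a : R, 0 <= a & x = a *: v].

Definition one_dimensional (sigma : set V) : Prop :=
  exists2 v : V, v != 0 & sigma = half_line v.

Definition face (tau sigma : set V) : Prop :=
  exists2 u : {linear V -> R^o},
    (forall x, sigma x -> 0 <= u x) & tau = sigma `&` [set x | u x = 0].
End Cones.

Section StackyFan.
Variables (R : realType) (N : zmodType).
Local Notation V := (realification R N).

Definition rational_simplicial_cone (sigma : set V) : Prop :=
  exists k (x : 'I_k -> N),
    rfree (fun i => to_real (x i) : V) /\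
    sigma = conic_hull (fun i => to_real (x i) : V).

Definition rational_simplicial_fan (Sigma : set (set V)) : Prop :=
  [/\ finite_set Sigma,
      forall sigma, Sigma sigma -> rational_simplicial_cone sigma,
      forall sigma tau, Sigma sigma -> face tau sigma -> Sigma tau
    & forall sigma tau, Sigma sigma -> Sigma tau ->
        face (sigma `&` tau) sigma /\ face (sigma `&` tau) tau].

Definition enumerates_rays (Sigma : set (set V)) (n : nat)
    (rho : 'I_n -> set V) : Prop :=
  injective rho /\
  range rho = [set sigma | Sigma sigma /\ one_dimensional sigma].

Definition stacky_fan (d n : nat) (Sigma : set (set V)) (rho : 'I_n -> set V)
    (beta : {additive 'rV[int]_n -> N}) : Prop :=
  [/\ finitely_generated N /\ has_rank N d,
      rational_simplicial_fan Sigma,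
      enumerates_rays Sigma rho,
      lin_span (\bigcup_j rho j) = setT
    & forall j, rho j = half_line (to_real (beta 'e_j))].
End StackyFan.

(** * The open set Z_Sigma *)

Section CoxOpenSet.
Variables (R : realType) (V : lmodType R) (n : nat).
Variables (Sigma : set (set V)) (rho : 'I_n -> set V).
Local Notation C := (Cx R).
Local Notation poly_ring := (mpoly.mpoly n C).

Definition cone_monomial (sigma : set V) : poly_ring :=
  \prod_(i < n | ~~ `[< rho i `<=` sigma >])
     mpoly.mpolyX C (mpoly.mnm1 i).

(* J(Sigma) *)
Definition irrelevant_ideal : set poly_ring :=
  [set f | exists k (c : 'I_k -> poly_ring) (sigma : 'I_k -> set V),
      (forall i, Sigma (sigma i)) /\
      f = \sum_i c i * cone_monomial (sigma i)].

Definition zero_locus (J : set poly_ring) : set 'rV[C]_n :=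
  [set z | forall f, J f -> mpoly.meval (fun i => z ord0 i) f = 0].

Definition cox_open_set : set 'rV[C]_n := ~` zero_locus irrelevant_ideal.
End CoxOpenSet.

(** * Smooth spaces and manifolds *)

(* Smooth structures are given by plots, as in diffeology: [plot X k U p] says
   that p, restricted to the open set U of R^k, is a smooth map to X (the values
   of p outside U are irrelevant).  Manifolds are the diffeological spaces that
   are locally diffeomorphic to R^d, Hausdorff and second countable; they form a
   full subcategory equivalent to the usual category of smooth manifolds. *)

Section SmoothFunctions.
Variable R : realType.

Fixpoint Ck (m k : nat) (U : set 'rV[R]_k) (f : 'rV[R]_k -> R) : Prop :=
  {in U, continuous f} /\
  (if m is m'.+1 then
     forall i : 'I_k, (forall u, U u -> derivable f u 'e_i) /\
                      Ck m' U (fun u => 'D_('e_i) f u)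
   else True).

Definition Cinfty (k : nat) (U : set 'rV[R]_k) (f : 'rV[R]_k -> R) : Prop :=
  forall m, Ck m U f.
End SmoothFunctions.

Record smooth_space (R : realType) := SmoothSpace {
  carrier :> Type;
  plot : forall k, set 'rV[R]_k -> ('rV[R]_k -> carrier) -> Prop }.

Section SmoothSpaces.
Variable R : realType.
Implicit Types X Y : smooth_space R.

Definition euclidean (d : nat) : smooth_space R :=
  @SmoothSpace R 'rV[R]_d
    (fun k U p => forall i, Cinfty U (fun u => p u ord0 i)).

Definition complex_line : smooth_space R :=
  @SmoothSpace R (Cx R)
    (fun k U p => Cinfty U (fun u => complex.Re (p u)) /\
                  Cinfty U (fun u => complex.Im (p u))).

Definition complex_space (n : nat) : smooth_space R :=
  @SmoothSpace R 'rV[Cx R]_n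
    (fun k U p => forall i, @plot R complex_line k U (fun u => p u ord0 i)).

Definition prod_space X Y : smooth_space R :=
  @SmoothSpace R (X * Y)%type
    (fun k U p => plot U (fst \o p) /\ plot U (snd \o p)).

Definition smooth_on X Y (A : set X) (f : X -> Y) : Prop :=
  forall k (U : set 'rV[R]_k) (p : 'rV[R]_k -> X),
    open U -> (forall u, U u -> A (p u)) -> plot U p -> plot U (f \o p).

Definition diffeomorphism X Y (A : set X) (B : set Y) (f : X -> Y) (g : Y -> X) :=
  [/\ forall x, A x -> B (f x) /\ g (f x) = x,
      forall y, B y -> A (g y) /\ f (g y) = y,
      smooth_on A f
    & smooth_on B g].

Definition diffeology X : Prop :=
  [/\ forall k (U : set 'rV[R]_k) (x : X), open U -> plot U (fun=> x),
      forall k (U : set 'rV[R]_k) (p q : 'rV[R]_k -> X),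
        open U -> {in U, p =1 q} -> plot U p -> plot U q,
      forall k l (U : set 'rV[R]_k) (V : set 'rV[R]_l)
          (p : 'rV[R]_k -> X) (f : 'rV[R]_l -> 'rV[R]_k),
        open U -> open V -> (forall v, V v -> U (f v)) ->
        @plot R (euclidean k) l V f -> plot U p -> plot V (p \o f)
    & forall k (U : set 'rV[R]_k) (p : 'rV[R]_k -> X), open U ->
        (forall u, U u -> exists W : set 'rV[R]_k,
           [/\ open W, W u, W `<=` U & plot W p]) ->
        plot U p].

Definition dopen X (A : set X) : Prop :=
  forall k (U : set 'rV[R]_k) (p : 'rV[R]_k -> X),
    open U -> plot U p -> open (U `&` p @^-1` A).

Definition locally_euclidean X : Prop :=
  forall x : X, exists (A : set X) d (V : set 'rV[R]_d) phi psi,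
    [/\ dopen A, A x, open V
      & @diffeomorphism X (euclidean d) A V phi psi].

Definition hausdorff_dtopology X : Prop :=
  forall x y : X, x <> y -> exists A B : set X,
    [/\ dopen A, dopen B, A x, B y & A `&` B = set0].

Definition second_countable_dtopology X : Prop :=
  exists B : nat -> set X, (forall i, dopen (B i)) /\
    forall A x, dopen A -> A x -> exists i, B i x /\ B i `<=` A.

Record manifold := Manifold {
  mfd_space :> smooth_space R;
  mfd_diffeology : diffeology mfd_space;
  mfd_chart : locally_euclidean mfd_space;
  mfd_hausdorff : hausdorff_dtopology mfd_space;
  mfd_second_countable : second_countable_dtopology mfd_space }.

Record smooth_map (M M' : manifold) := SmoothMap {
  smap_fun :> M -> M';
  smap_smooth : smooth_on setT smap_fun }.

Definition smap_id (M : manifold) : smooth_map M M.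
Proof. by exists idfun => k U p. Defined.

Definition smap_comp (M M' M'' : manifold)
  (psi : smooth_map M' M'') (phi : smooth_map M M') : smooth_map M M''.
Proof.
exists (psi \o phi) => k U p oU pU sp.
exact: (smap_smooth psi oU (fun _ _ => I) (smap_smooth phi oU pU sp)).
Defined.

End SmoothSpaces.

(** * Quotient stacks over the category of manifolds *)

(* A group [grp] acting on a space [spc].  As for finite groups in MathComp,
   both are subsets of ambient types carrying the operations and the smooth
   structures; nothing is assumed outside these subsets. *)
Record smooth_action (R : realType) := SmoothAction {
  grp_amb : smooth_space R;
  grp : set grp_amb;
  grp_one : grp_amb;
  grp_mul : grp_amb -> grp_amb -> grp_amb;
  spc_amb : smooth_space R;
  spc : set spc_amb;
  action : grp_amb -> spc_amb -> spc_amb }.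
Arguments grp {R} s.
Arguments spc {R} s.
Arguments grp_one {R} s.

Section QuotientStack.
Variables (R : realType) (Q : smooth_action R).
Local Notation G := (grp Q).

(* An object of [X/G] over M: a principal G-bundle P -> M and an equivariant
   smooth map P -> X. *)
Record quotient_obj (M : manifold R) := QuotientObj {
  total : manifold R;
  bproj : total -> M;
  bact : grp_amb Q -> total -> total;
  bmap : total -> spc_amb Q;
  bproj_smooth : smooth_on setT bproj;
  bact_smooth : @smooth_on R (prod_space (grp_amb Q) total) total
                  (G `*` setT) (fun gx => bact gx.1 gx.2);
  bact1 : forall x, bact (grp_one Q) x = x;
  bactM : forall g h x, G g -> G h -> bact (grp_mul g h) x = bact g (bact h x);
  bproj_act : forall g x, G g -> bproj (bact g x) = bproj x;
  (* locally P is A x G, with G acting by translation on the second factor *)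
  btriv : forall m : M, exists (A : set M) (gamma : total -> grp_amb Q)
                               (psi : M * grp_amb Q -> total),
    [/\ dopen A, A m,
        @diffeomorphism R total (prod_space M (grp_amb Q))
          (bproj @^-1` A) (A `*` G) (fun x => (bproj x, gamma x)) psi
      & forall g x, G g -> A (bproj x) -> gamma (bact g x) = grp_mul g (gamma x)];
  bmap_spc : forall x, spc Q (bmap x);
  bmap_smooth : smooth_on setT bmap;
  bmap_act : forall g x, G g -> bmap (bact g x) = action g (bmap x) }.

Record quotient_hom (M M' : manifold R) (phi : smooth_map M M')
    (P : quotient_obj M) (P' : quotient_obj M') := QuotientHom {
  qhom_fun :> total P -> total P';
  qhom_smooth : smooth_on setT qhom_fun;
  qhom_act : forall g x, G g -> qhom_fun (bact g x) = bact g (qhom_fun x);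
  qhom_proj : forall x, bproj (qhom_fun x) = phi (bproj x);
  qhom_map : forall x, bmap (qhom_fun x) = bmap x }.

Definition qhom_id (M : manifold R) (P : quotient_obj M) :
  quotient_hom (smap_id M) P P.
Proof. by exists idfun => // k U p. Defined.

Definition qhom_comp (M M' M'' : manifold R)
    (psi : smooth_map M' M'') (phi : smooth_map M M')
    (P : quotient_obj M) (P' : quotient_obj M') (P'' : quotient_obj M'')
    (g : quotient_hom psi P' P'') (f : quotient_hom phi P P') :
  quotient_hom (smap_comp psi phi) P P''.
Proof.
exists (g \o f) => [k U p oU pU sp|h x Gh|x|x] /=.
- exact: (qhom_smooth g oU (fun _ _ => I) (qhom_smooth f oU pU sp)).
- by rewrite !qhom_act.
- by rewrite !qhom_proj.
- by rewrite !qhom_map.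
Defined.

End QuotientStack.

(* Equivalence of the stacks [X/G] and [X'/G'], as categories fibred in
   groupoids over manifolds: a functor over manifolds that is fully faithful and
   essentially surjective on each fibre. *)
Definition stack_equivalent (R : realType) (Q Q' : smooth_action R) : Prop :=
  exists (F : forall M, quotient_obj Q M -> quotient_obj Q' M)
         (F1 : forall M M' (phi : smooth_map M M')
                 (P : quotient_obj Q M) (P' : quotient_obj Q M'),
                 quotient_hom phi P P' -> quotient_hom phi (F M P) (F M' P')),
  [/\ forall M (P : quotient_obj Q M), F1 _ _ _ _ _ (qhom_id P) = qhom_id (F M P),
      forall M M' M'' (psi : smooth_map M' M'') (phi : smooth_map M M')
             (P : quotient_obj Q M) (P' : quotient_obj Q M')
             (P'' : quotient_obj Q M'')
             (g : quotient_hom psi P' P'') (f : quotient_hom phi P P'),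
        F1 _ _ _ _ _ (qhom_comp g f) =
        qhom_comp (F1 _ _ _ _ _ g) (F1 _ _ _ _ _ f),
      forall M M' (phi : smooth_map M M')
             (P : quotient_obj Q M) (P' : quotient_obj Q M'),
        bijective (F1 M M' phi P P')
    & forall M (P' : quotient_obj Q' M), exists (P : quotient_obj Q M)
        (f : quotient_hom (smap_id M) (F M P) P')
        (g : quotient_hom (smap_id M) P' (F M P)),
        cancel f g /\ cancel g f].

(** * The group DG(beta) and the toric Deligne-Mumford stack *)

(* Z^m is 'rV[int]_m, a matrix A : 'M_(m, m') stands for the homomorphism
   v |-> v *m A.  In the dual bases (Z^m)^* is 'cV[int]_m, f standing for the
   functional v |-> v *m f, so that A^* is f |-> A *m f. *)
Record resolution_with_lift (d n : nat) (N : zmodType)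
    (beta : {additive 'rV[int]_n -> N}) := ResolutionWithLift {
  ell : nat;
  resQ : 'M[int]_(ell, d + ell);
  resP : {additive 'rV[int]_(d + ell) -> N};
  liftB : 'M[int]_(n, d + ell);
  resQ_inj : injective (fun v : 'rV[int]_ell => v *m resQ);
  res_exact : forall w, resP w = 0 <-> exists v, w = v *m resQ;
  resP_surj : range resP = setT;
  liftB_lift : forall v, resP (v *m liftB) = beta v }.

Section ToricStack.
Variables (R : realType) (d n : nat) (N : zmodType).
Variables (beta : {additive 'rV[int]_n -> N}).
Variables (r : resolution_with_lift d beta).
Local Notation C := (Cx R).

Definition BQ : 'M[int]_(n + ell r, d + ell r) := col_mx (liftB r) (resQ r).

Definition im_dual : {pred 'cV[int]_(n + ell r)} :=
  fun y => `[< exists f : 'cV[int]_(d + ell r), y = BQ *m f >].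

Fact im_dual_zmod : zmod_closed im_dual.
Proof.
split; first by apply/asboolP; exists 0; rewrite mulmx0.
move=> x y /asboolP[f ->] /asboolP[g ->].
by apply/asboolP; exists (f - g); rewrite mulmxBr.
Qed.
HB.instance Definition _ := GRing.isZmodClosed.Build _ im_dual im_dual_zmod.

Definition DG : zmodType := Quotient.quot im_dual.

Definition beta_dual (f : 'cV[int]_n) : DG := \pi_DG (col_mx f 0).

(* The smooth structure of Hom(DG(beta), C^* ) as a closed subgroup of the torus
   Hom(Z^(n + l), C^* ): a family of characters is smooth iff its values are. *)
Definition char_space : smooth_space R :=
  @SmoothSpace R (DG -> C)
    (fun k U p => forall x, @plot R (complex_line R) k U (fun u => p u x)).

(* Hom(DG(beta), C^* ) *)
Definition torus_hom : set char_space :=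
  [set chi : DG -> C | (forall x, chi x != 0) /\
                       (forall x y, chi (x + y) = chi x * chi y)].

Definition char_one : char_space := fun=> 1.
Definition char_mul (chi chi' : char_space) : char_space :=
  fun x => chi x * chi' x.

(* The action of G through G -> T^n, whose j-th component is the value on
   beta_dual of the j-th element of the dual basis. *)
Definition torus_action (chi : char_space) (z : 'rV[C]_n) : 'rV[C]_n :=
  \row_j (chi (beta_dual ('e_j)^T) * z ord0 j).

Definition torus_quotient (H : set char_space) (Z : set 'rV[C]_n) :
    smooth_action R :=
  @SmoothAction R char_space H char_one char_mul
    (complex_space R n) Z torus_action.

(* The topology on characters is that of pointwise convergence. *)
Definition identity_component : set char_space :=
  connected_component (torus_hom : set {ptws DG -> C}) char_one.

Definition toric_stack (Sigma : set (set (realification R N)))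
    (rho : 'I_n -> set (realification R N)) : smooth_action R :=
  torus_quotient torus_hom (cox_open_set Sigma rho).

End ToricStack.
Arguments DG {d n N beta} r.
Arguments torus_hom R {d n N beta} r.
Arguments char_space R {d n N beta} r.
Arguments torus_quotient R {d n N beta} r H Z.
Arguments identity_component R {d n N beta} r.
Arguments toric_stack {R d n N beta} r Sigma rho.
Arguments torus_action {R d n N beta r} chi z.

(** * The stacky fan (N_0, Sigma_0, beta_0) *)

Section ImageFan.
Variables (R : realType) (n : nat) (N : zmodType).
Variable beta : {additive 'rV[int]_n -> N}.

(* N_0 (x) R -> N (x) R *)
Definition im_realification :
    realification R (im_group beta) -> realification R N :=
  realification_map (val : {additive im_group beta -> N}).

Definition im_cone (sigma : set (realification R N)) :
    set (realification R (im_group beta)) := im_realification @^-1` sigma.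

Definition im_fan (Sigma : set (set (realification R N))) :
    set (set (realification R (im_group beta))) := im_cone @` Sigma.
End ImageFan.
Arguments im_realification R {n N} beta.
Arguments im_cone {R n N} beta sigma.
Arguments im_fan {R n N} beta Sigma.

(* Main.v *)
Require Import Defs.
From HB Require Import structures.
From mathcomp Require Import all_boot all_order all_algebra.
From mathcomp Require Import complex.
From mathcomp Require Import all_classical all_reals all_analysis.

Set Implicit Arguments.
Unset Strict Implicit.
Unset Printing Implicit Defensive.

Import Order.TTheory GRing.Theory Num.Theory.
Import numFieldNormedType.Exports.

Local Open Scope classical_set_scope.
Local Open Scope quotient_scope.
Local Open Scope ring_scope.

(** Each ray is spanned by some beta(e_j) (x) 1 and the rays span N (x) R, so a
homomorphism from N to the real numbers that kills im(beta) is zero.  As N is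
finitely generated, this forces m N to lie in N_0 = im(beta) for some m > 0
([stacky_fan_finite_index]).  Multiplication by m is then an inverse, up to the
factor m, of the inclusion of N_0 in N; since m is invertible in R, the map
N_0 (x) R -> N (x) R is a linear bijection ([im_realification_bij]), along which
all the conditions on the fan are transported ([stacky_fan_im]).  The open set
Z_Sigma depends only on which rays lie in which cones, hence does not change
([cox_open_set_im]).

For the groups, lift the inclusion of N_0 in N to a morphism between the maps
[B_0 Q_0] and [B Q] of free groups.  Its dual induces a homomorphism theta from
DG(beta) to DG(beta_0) that commutes with the maps from the dual of Z^n
([DG_restriction]).  The kernels of [B_0 Q_0] and [B Q] both project
isomorphically onto ker(beta), so the morphism is an isomorphism on kernels.
Since the kernel of [B Q] is a direct summand, functionals on it extend, and
theta is onto; since m kills the cokernel of [B Q], it kills ker(theta); and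
since [B_0 Q_0] is onto, DG(beta_0) embeds as a direct summand in a free group.

Composition with theta therefore identifies G_0 = Hom(DG(beta_0), T) with the
characters of DG(beta) that are trivial on ker(theta), and these form the
identity component of G ([identity_component_iso]).  Indeed, on an element of
ker(theta) a character takes an m-th root of unity as value, and a continuous
function with finitely many values is constant on a connected set
([character_component_torsion]).  Conversely a character that factors through
the lattice DG(beta_0) is a monomial in finitely many nonzero complex numbers,
each of which can be joined to 1 away from 0 ([torus_character_component]).

Finally, an isomorphism of groups that is compatible with two actions on the
same space identifies principal bundles of one group with principal bundles of
the other on the same total spaces, and hence the two quotient stacks
([action_iso_stack_equivalent]). *)

(** * Functoriality of N (x) R *)

Section RealificationMap.
Variables (R : realType).

Lemma tens_val_map (N N' : zmodType) (h : {additive N -> N'}) (W : zmodType)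
    (f : N' -> R -> W) (x : realification R N) :
  biadditive f ->
  tens_val f (realification_map h x) = tens_val (fun v a => f (h v) a) x.
Proof. by move=> bf; rewrite tens_val_pi // /tsum big_map. Qed.

Lemma biadditive_map (N N' W : zmodType) (h : {additive N -> N'})
    (f : N' -> R -> W) :
  biadditive f -> biadditive (fun v a => f (h v) a).
Proof. by case=> fD fd; split=> *; rewrite ?raddfD ?fD ?fd. Qed.

Fact realification_map_is_linear (N N' : zmodType) (h : {additive N -> N'}) :
  linear (realification_map h : realification R N -> realification R N').
Proof.
move=> a x y; apply: tens_val_inj => W f bf.
have bh := biadditive_map h bf.
rewrite [LHS]tens_val_map // !tens_valD // !tens_valZ //.
by rewrite !tens_val_map //; apply: biadditive_scale.
Qed.
HB.instance Definition _ N N' h :=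
  GRing.isLinear.Build R _ _ _ (@realification_map R N N' h)
    (realification_map_is_linear h).

Lemma tens_val_to_real (N W : zmodType) (f : N -> R -> W) (x : N) :
  biadditive f -> tens_val f (to_real x) = f x 1.
Proof. by move=> bf; rewrite tens_val_pi // /tsum big_seq1. Qed.

Lemma realification_map_to_real (N N' : zmodType) (h : {additive N -> N'}) x :
  realification_map h (to_real x) = to_real (h x) :> realification R N'.
Proof.
apply: tens_val_inj => W f bf; rewrite tens_val_map // !tens_val_to_real //.
exact: biadditive_map.
Qed.

Lemma biadditive_natl (N W : zmodType) (f : N -> R -> W) (x : N) a m :
  biadditive f -> f (x *+ m) a = f x (m%:R * a).
Proof.
move=> [fD fd]; have f0 : f 0 a = 0.
  by apply: (@addrI _ (f 0 a)); rewrite -fD !addr0.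
have f0' : f x 0 = 0 by apply: (@addrI _ (f x 0)); rewrite -fd !addr0.
elim: m => [|m IH]; first by rewrite mulr0n mul0r f0 f0'.
by rewrite mulrS fD IH mulrS mulrDl mul1r fd.
Qed.

Lemma to_real_natmul (N : zmodType) (x : N) m :
  to_real (x *+ m) = m%:R *: to_real x :> realification R N.
Proof.
apply: tens_val_inj => W f bf.
rewrite tens_valZ // !tens_val_to_real //; last exact: biadditive_scale.
by rewrite (biadditive_natl _ _ _ bf).
Qed.

Lemma realification_map_natmul (N N' : zmodType) (h : {additive N -> N'})
    (k : {additive N' -> N}) m (y : realification R N') :
  (forall x, h (k x) = x *+ m) ->
  realification_map h (realification_map k y) = m%:R *: y.
Proof.
move=> hk; apply: tens_val_inj => W f bf.
have bh := biadditive_map h bf.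
rewrite tens_valZ // !tens_val_map // /tens_val /tsum.
by apply: eq_bigr => p _; rewrite hk (biadditive_natl _ _ _ bf).
Qed.

(** After tensoring with R, two homomorphisms whose composites both are
multiplication by m become inverse to each other up to the unit m. *)
Lemma realification_map_isogeny_bij (N N' : zmodType) (h : {additive N -> N'})
    (k : {additive N' -> N}) m :
  (0 < m)%N -> (forall x, h (k x) = x *+ m) -> (forall x, k (h x) = x *+ m) ->
  bijective (realification_map h : realification R N -> realification R N').
Proof.
move=> m0 hk kh; have mu : (m%:R : R) != 0 by rewrite pnatr_eq0 -lt0n.
exists (fun y => m%:R^-1 *: realification_map k y) => y.
  by rewrite (realification_map_natmul y kh) scalerA mulVf // scale1r.
by rewrite linearZ /= (realification_map_natmul y hk) scalerA mulVf // scale1r.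
Qed.

End RealificationMap.

(** * Finitely generated torsion quotients *)

(** The span of a possibly infinite set of integer vectors is reached by finitely
many of them: any family of maximal rank will do. *)
Lemma spanning_rows p (S : set 'rV[int]_p) :
  exists k (A : 'M[int]_(k, p)), (forall i, S (row i A)) /\
    forall w, S w -> (map_mx intr w <= (map_mx intr A : 'M[rat]_(k, p)))%MS.
Proof.
pose P r := `[< exists k (A : 'M[int]_(k, p)), (forall i, S (row i A)) /\
  \rank (map_mx intr A : 'M[rat]_(k, p)) = r >].
have exP : exists r, P r.
  by exists (\rank (map_mx intr (0 : 'M[int]_(0, p)) : 'M[rat]_(0, p)));
    apply/asboolP; exists 0%N, 0; split=> // -[].
have ubP r : P r -> (r <= p)%N by move/asboolP => [k [A [_ <-]]]; exact: rank_leq_col.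
case: (ex_maxnP exP ubP) => r /asboolP[k [A [AS rA]]] maxr.
exists k, A; split=> // w Sw.
have : P (\rank (map_mx intr (col_mx A w) : 'M[rat]_(k + 1, p))).
  apply/asboolP; exists (k + 1)%N, (col_mx A w); split=> // i.
  case: (split_ordP i) => j ->; first by rewrite rowKu.
  by rewrite rowKd (ord1 j) (_ : row 0 w = w) //; apply/rowP => l; rewrite !mxE.
move/maxr; rewrite -rA map_col_mx => le.
have sub : (map_mx intr A <=
    col_mx (map_mx intr A : 'M[rat]_(k, p)) (map_mx intr w))%MS.
  by rewrite -addsmxE addsmxSl.
have := mxrank_leqif_sup sub; move/leqifP; case: ifP => [+ _|_];
  last by rewrite ltnNge le.
by rewrite -addsmxE => /(submx_trans (addsmxSr _ _)).
Qed.

(** Write N as a quotient of Z^p and let A have rows spanning the preimage of S over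
the rationals.  A column c with A c = 0 defines a homomorphism from N to the
rationals that kills S, so there is no such c but 0 and A has full rank.  If B is
an invertible square submatrix of A, then det(B) w = (w adj(B)) B is an integral
combination of rows of A for every w, and |det(B)| is the required exponent. *)
Lemma torsion_quotient_of_rat_hom (N : zmodType) (S : zmodClosed N) :
  finitely_generated N ->
  (forall h : {additive N -> rat}, (forall x, x \in S -> h x = 0) ->
     forall x, h x = 0) ->
  exists2 m, (0 < m)%N & forall x, x *+ m \in S.
Proof.
move=> [p [g gT]] hom0.
have [k [A [AS spanA]]] := spanning_rows [set w | g w \in S].
pose Aq : 'M[rat]_(k, p) := map_mx intr A.
have fullA : row_full Aq.
  rewrite -cokermx_eq0; apply/eqP.
  (* The columns of the cokernel matrix are the candidates for c. *)
  suff c0 j : col j (cokermx Aq) = 0.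
    by apply/matrixP => i j; have /colP/(_ i) := c0 j; rewrite !mxE.
  set c := col j _.
  have Sc w : g w \in S -> map_mx intr w *m c = 0.
    move=> /spanA; rewrite -/Aq => /submxP[u ->].
    have -> : c = cokermx Aq *m delta_mx j 0 by rewrite -colE.
    by rewrite -mulmxA (mulmxA Aq) mulmx_coker mul0mx mulmx0.
  have lift x : exists w, g w = x.
    by have [w _ <-] : range g x; [rewrite gT | exists w].
  pose l x := projT1 (cid (lift x)).
  have gl x : g (l x) = x by rewrite /l; case: cid.
  pose h (x : N) : rat := (map_mx intr (l x) *m c) 0 0.
  have hE w : h (g w) = (map_mx intr w *m c) 0 0.
    have /Sc : g (l (g w) - w) \in S by rewrite raddfB gl subrr rpred0.
    rewrite map_mxB mulmxBl => /eqP; rewrite subr_eq0 => /eqP e.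
    by rewrite /h e.
  have hB : zmod_morphism h.
    move=> x y; rewrite -[in LHS](gl x) -[in LHS](gl y) -raddfB hE.
    by rewrite map_mxB mulmxBl /h mxE [X in _ + X]mxE.
  pose hA : {additive N -> rat} :=
    HB.pack h (GRing.isZmodMorphism.Build N rat h hB).
  have h0 x : h x = 0.
    by apply: (hom0 hA) => y yS /=; rewrite -[y]gl hE Sc ?gl // mxE.
  apply/colP => i; rewrite [RHS]mxE -(h0 (g (delta_mx 0 i))) hE.
  rewrite (_ : map_mx intr _ = delta_mx 0 i); last by rewrite map_delta_mx.
  by rewrite -rowE !mxE.
pose f := fullrankfun fullA.
pose B : 'M[int]_p := rowsub f A.
have BS i : g (row i B) \in S by have /= := AS (f i); rewrite row_rowsub.
have detB : \det B != 0.
  have : (map_mx intr B : 'M[rat]_p) \in unitmx.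
    rewrite /B map_mxsub; exact: fullrowsub_unit.
  rewrite unitmxE (det_map_mx intr) unitfE => /eqP dB.
  by apply/eqP => d0; apply: dB; rewrite d0.
exists `|\det B|%N; first by rewrite absz_gt0.
move=> x; have [w _ <-] : range g x by rewrite gT.
have gS u : g (u *m B) \in S.
  rewrite mulmx_sum_row raddf_sum rpred_sum // => i _.
  by rewrite -[u 0 i]intz scaler_int raddfMz rpredMz.
have detS : g w *~ \det B \in S.
  rewrite -raddfMz; have -> : w *~ \det B = (w *m \adj B) *m B.
    by rewrite -mulmxA mul_adj_mx mul_mx_scalar -[in RHS](intz (\det B)) scaler_int.
  exact: gS.
by move: detS; case: (\det B) => e /=; rewrite ?NegzE ?mulrNz ?rpredN.
Qed.

(** * Cones under linear bijections *)

Section LinearIso.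
Variables (R : realType) (U V : lmodType R) (f : {linear U -> V}).

Lemma face_preimage (tau sigma : set V) :
  face tau sigma -> face (f @^-1` tau) (f @^-1` sigma).
Proof.
case=> u u_ge0 ->; exists (u \o f : {linear U -> R^o}) => // x.
exact: u_ge0.
Qed.

Lemma lin_span_preimage (g : V -> U) (A : set V) :
  cancel f g -> cancel g f -> lin_span A = setT -> lin_span (f @^-1` A) = setT.
Proof.
move=> fK gK spanA; apply/seteqP; split=> // x _.
have [k [c [v [Av fx]]]] : lin_span A (f x) by rewrite spanA.
exists k, c, (g \o v); split=> [i|]; first by rewrite /= gK.
apply: (can_inj fK); rewrite fx linear_sum.
by apply: eq_bigr => i _; rewrite linearZ /= gK.
Qed.

Lemma half_line_preimage (v : U) :
  injective f -> f @^-1` half_line (f v) = half_line v.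
Proof.
move=> finj; apply/seteqP; split=> x /= [a a0].
  by rewrite -linearZ => /finj ->; exists a.
by move=> ->; exists a => //; rewrite linearZ.
Qed.

Lemma rfree_image k (v : 'I_k -> U) : rfree (fun i => f (v i)) -> rfree v.
Proof.
move=> free c c0; apply: free.
have <- : f (\sum_i c i *: v i) = \sum_i c i *: f (v i).
  by rewrite linear_sum; apply: eq_bigr => i _; rewrite linearZ.
by rewrite c0 linear0.
Qed.

Lemma conic_hull_preimage k (v : 'I_k -> U) :
  injective f -> f @^-1` conic_hull (fun i => f (v i)) = conic_hull v.
Proof.
move=> finj.
have fsum (a : 'I_k -> R) : f (\sum_i a i *: v i) = \sum_i a i *: f (v i).
  by rewrite linear_sum; apply: eq_bigr => i _; rewrite linearZ.
apply/seteqP; split=> x /= [a a0].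
  by rewrite -fsum => /finj ->; exists a.
by move=> ->; exists a => //; rewrite fsum.
Qed.

End LinearIso.

Lemma one_dimensional_preimage (R : realType) (U V : lmodType R)
    (f : {linear U -> V}) (g : V -> U) (sigma : set V) :
  cancel f g -> cancel g f ->
  one_dimensional sigma -> one_dimensional (f @^-1` sigma).
Proof.
move=> fK gK [v v0 ->]; exists (g v).
  by apply: contra_neq v0 => gv0; rewrite -[v]gK gv0 linear0.
by rewrite -[v in LHS]gK half_line_preimage //; exact: can_inj fK.
Qed.

Lemma rfree_scale (R : realType) (V : lmodType R) (a : R) k (v : 'I_k -> V) :
  a != 0 -> rfree v -> rfree (fun i => a *: v i).
Proof.
move=> a0 free c c0 i.
have /(_ i)/eqP : forall i, c i * a = 0.
  by apply: free; rewrite -[RHS]c0; apply: eq_bigr => j _; rewrite scalerA.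
by rewrite mulf_eq0 (negPf a0) orbF => /eqP.
Qed.

Lemma conic_hull_scale (R : realType) (V : lmodType R) (a : R) k (v : 'I_k -> V) :
  0 < a -> conic_hull (fun i => a *: v i) = conic_hull v.
Proof.
move=> a0; apply/seteqP; split=> x [c c0 ->].
  exists (fun i => c i * a) => [i|]; first by rewrite mulr_ge0 // ltW.
  by apply: eq_bigr => i _; rewrite scalerA.
exists (fun i => c i / a) => [i|]; first by rewrite divr_ge0 // ltW.
by apply: eq_bigr => i _; rewrite scalerA divfK // gt_eqF.
Qed.

(** * The image of beta has finite index *)

Section FiniteIndex.
Variables (R : realType) (d n : nat) (N : zmodType).
Variables (Sigma : set (set (realification R N))).
Variables (rho : 'I_n -> set (realification R N)).
Variables (beta : {additive 'rV[int]_n -> N}).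

(** The linear extension of h to N (x) R vanishes on the rays, hence everywhere,
and its value at x (x) 1 is h x. *)
Lemma rays_span_additive_eq0 (h : {additive N -> R}) :
  stacky_fan d Sigma rho beta -> (forall v, h (beta v) = 0) ->
  forall x, h x = 0.
Proof.
move=> [_ _ _ span rhoE] h0 x.
pose f v (a : R) := h v * a.
have bf : biadditive f by split=> *; rewrite /f ?raddfD ?mulrDl ?mulrDr.
pose phi (y : realification R N) := tens_val f y.
have phiZ a y : phi (a *: y) = a * phi y.
  rewrite /phi tens_valZ // /tens_val /tsum mulr_sumr.
  by apply: eq_bigr => p _; rewrite /f mulrCA.
have : lin_span (\bigcup_j rho j) (to_real x) by rewrite span.
case=> k [c [v [rv xE]]].
have -> : h x = phi (to_real x) by rewrite /phi tens_val_to_real // /f mulr1.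
rewrite xE (big_morph phi (fun y z => tens_valD y z bf) (tens_val0 bf)).
apply: big1 => i _; have [j _] := rv i; rewrite rhoE => -[a _ ->].
by rewrite !phiZ /phi tens_val_to_real // /f h0 mul0r !mulr0.
Qed.

Lemma stacky_fan_finite_index :
  stacky_fan d Sigma rho beta ->
  exists2 m, (0 < m)%N & forall x, x *+ m \in im_pred beta.
Proof.
move=> fan; have [[fgN _] _ _ _ _] := fan.
apply: torsion_quotient_of_rat_hom => // h h0 x.
apply/eqP; rewrite -(fmorph_eq0 (ratr : rat -> R)); apply/eqP.
apply: (rays_span_additive_eq0 (h := ratr \o h)) => // v /=.
by rewrite h0 ?rmorph0 // im_pred_beta.
Qed.

Section Multiplication.
Variables (m : nat) (mN : forall x, x *+ m \in im_pred beta).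

Definition mul_to_im (x : N) : im_group beta := exist _ (x *+ m) (mN x).

Fact mul_to_im_zmod_morphism : zmod_morphism mul_to_im.
Proof. by move=> x y; apply: val_inj; rewrite raddfB /= mulrnBl. Qed.
HB.instance Definition _ :=
  GRing.isZmodMorphism.Build _ _ mul_to_im mul_to_im_zmod_morphism.

Lemma mul_to_im_val x : mul_to_im (val x) = x *+ m.
Proof. by apply: val_inj; rewrite raddfMn. Qed.

Lemma im_realification_bij : (0 < m)%N -> bijective (im_realification R beta).
Proof.
move=> m0; pose k : {additive N -> im_group beta} := mul_to_im.
exact: (realification_map_isogeny_bij (k := k) R m0 _ mul_to_im_val).
Qed.

End Multiplication.

End FiniteIndex.

(** * The fan of N_0 and its open set *)

Section ImageStackyFan.
Variables (R : realType) (d n : nat) (N : zmodType).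
Variables (Sigma : set (set (realification R N))).
Variables (rho : 'I_n -> set (realification R N)).
Variables (beta : {additive 'rV[int]_n -> N}).

Lemma has_rank_im m :
  (0 < m)%N -> (forall x, x *+ m \in im_pred beta) ->
  has_rank N d -> has_rank (im_group beta) d.
Proof.
move=> m0 mN [[x freex] maxd]; split.
  exists (fun i => mul_to_im mN (x i)) => c c0 i.
  have /(_ i)/eqP : forall i, c i * m%:Z = 0.
    apply: freex.
    have <- : val (\sum_i mul_to_im mN (x i) *~ c i) = \sum_i x i *~ (c i * m%:Z).
      by rewrite raddf_sum; apply: eq_bigr => j _; rewrite raddfMz /= mulrC mulrzA.
    by rewrite c0.
  by rewrite mulf_eq0 eqz_nat (gtn_eqF m0) orbF => /eqP.
move=> y freey; apply: (maxd (fun i => val (y i))) => c c0; apply: freey.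
apply: val_inj; rewrite [RHS]raddf0 -[RHS]c0 raddf_sum.
by apply: eq_bigr => i _; rewrite raddfMz.
Qed.

Lemma finitely_generated_im : finitely_generated (im_group beta).
Proof.
exists n, (corestrict beta); apply/seteqP; split=> // -[x xim] _.
by have /asboolP[v _ vx] := xim; exists v => //; apply: val_inj.
Qed.

Hypothesis fan : stacky_fan d Sigma rho beta.

Local Notation f := (realification_map
  (val : {additive im_group beta -> N}) :
    {linear realification R (im_group beta) -> realification R N}).

Let f_bij : bijective f.
Proof.
have [m m0 mN] := stacky_fan_finite_index fan.
exact: im_realification_bij mN m0.
Qed.

Lemma im_cone_inj : injective (im_cone (R := R) beta).
Proof.
move=> s t st; have [g _ gK] := f_bij.
have E (u : set (realification R N)) : u = g @^-1` im_cone beta u.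
  by apply/seteqP; split=> x /=; rewrite /im_cone /im_realification /= gK.
by rewrite (E s) (E t) st.
Qed.

Lemma im_cone_subset (s t : set (realification R N)) :
  im_cone beta s `<=` im_cone beta t <-> s `<=` t.
Proof.
have [g _ gK] := f_bij; split=> st x; last exact: st.
by rewrite -(gK x); apply: st.
Qed.

(** The generators x_i of a cone need not lie in N_0, but their multiples m x_i do
and generate the same cone. *)
Lemma rational_simplicial_cone_im sigma :
  rational_simplicial_cone (R := R) sigma ->
  rational_simplicial_cone (R := R) (im_cone beta sigma).
Proof.
move=> [k [x [freex ->]]].
have [m m0 mN] := stacky_fan_finite_index fan.
have mR : 0 < (m%:R : R) by rewrite ltr0n.
pose y i := mul_to_im mN (x i).
have fy i : f (to_real (y i)) = m%:R *: to_real (x i).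
  by rewrite /= realification_map_to_real -to_real_natmul.
have fyE : (fun i => f (to_real (y i))) = (fun i => m%:R *: to_real (x i)).
  by apply: funext => i; rewrite fy.
exists k, y; split.
  by apply: (rfree_image (f := f)); rewrite fyE; apply: rfree_scale; rewrite ?gt_eqF.
rewrite -(conic_hull_preimage (f := f)) ?fyE ?conic_hull_scale //.
exact: bij_inj f_bij.
Qed.

Lemma face_im_cone tau sigma :
  face tau sigma -> face (im_cone (R := R) beta tau) (im_cone beta sigma).
Proof. exact: (face_preimage f). Qed.

Lemma face_of_im_cone tau sigma :
  face tau (im_cone (R := R) beta sigma) ->
  exists2 tau', face tau' sigma & tau = im_cone beta tau'.
Proof.
have [g fK gK] := f_bij.
pose gL : {linear realification R N -> realification R (im_group beta)} :=
  HB.pack g (GRing.isLinear.Build _ _ _ _ g (can2_linear fK gK)).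
move=> /(face_preimage gL) face_g; exists (gL @^-1` tau).
  rewrite (_ : sigma = gL @^-1` im_cone beta sigma) //.
  by apply/seteqP; split=> x /=; rewrite /im_cone /im_realification /= gK.
by apply/seteqP; split=> x /=; rewrite /im_cone /im_realification /= fK.
Qed.

Lemma one_dimensional_im_cone sigma :
  one_dimensional (im_cone (R := R) beta sigma) <-> one_dimensional sigma.
Proof.
have [g fK gK] := f_bij.
pose gL : {linear realification R N -> realification R (im_group beta)} :=
  HB.pack g (GRing.isLinear.Build _ _ _ _ g (can2_linear fK gK)).
split; last exact: one_dimensional_preimage fK gK.
move=> /(one_dimensional_preimage (f := gL) gK fK).
rewrite (_ : gL @^-1` im_cone beta sigma = sigma) //.
by apply/seteqP; split=> x /=; rewrite /im_cone /im_realification /= gK.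
Qed.

Lemma rational_simplicial_fan_im : rational_simplicial_fan (im_fan beta Sigma).
Proof.
have [_ [finS simpS faceS meetS] _ _ _] := fan; split.
- exact: finite_image.
- by move=> _ [s /simpS ss <-]; apply: rational_simplicial_cone_im.
- move=> _ tau [s Ss <-] /face_of_im_cone[t ts ->].
  by exists t => //; apply: faceS ts.
- move=> _ _ [s Ss <-] [t St <-].
  have [/face_im_cone ms /face_im_cone mt] := meetS s t Ss St.
  by split; [exact: ms | exact: mt].
Qed.

Lemma stacky_fan_im :
  stacky_fan d (im_fan beta Sigma) (fun j => im_cone beta (rho j)) (corestrict beta).
Proof.
have [m m0 mN] := stacky_fan_finite_index fan.
have [[_ rankN] _ [rho_inj rhoS] span rhoE] := fan; split.
- split; [exact: finitely_generated_im | exact: has_rank_im mN rankN].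
- exact: rational_simplicial_fan_im.
- split=> [i j /im_cone_inj/rho_inj //|].
  apply/seteqP; split=> [_ [j _ <-]|_ [[s Ss <-] /one_dimensional_im_cone s1]].
    have [Sj j1] : [set s | Sigma s /\ one_dimensional s] (rho j).
      by rewrite -rhoS; exists j.
    by split; [exists (rho j) | apply/one_dimensional_im_cone].
  have [j _ <-] : range rho s by rewrite rhoS.
  by exists j.
- have [g fK gK] := f_bij; rewrite -(lin_span_preimage fK gK span).
  by congr lin_span; rewrite preimage_bigcup.
- move=> j; rewrite rhoE -(half_line_preimage (f := f)); last exact: bij_inj f_bij.
  by rewrite /= realification_map_to_real.
Qed.

(** Both irrelevant ideals have the same generators, because taking preimages under a
bijection preserves and reflects the inclusion of rays in cones. *)
Lemma cox_open_set_im :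
  cox_open_set (im_fan beta Sigma) (fun j => im_cone beta (rho j)) =
  cox_open_set Sigma rho.
Proof.
have monE s : cone_monomial (fun j => im_cone beta (rho j)) (im_cone beta s) =
              cone_monomial rho s.
  by apply: eq_bigl => j; congr (~~ _); apply: asbool_equiv_eq; exact: im_cone_subset.
rewrite /cox_open_set; congr (~` zero_locus _).
apply/seteqP; split=> p [k [c [s [Ss ->]]]].
  have [t tE] := choice (fun i => let: ex_intro2 t St ts := Ss i in
    ex_intro (fun t => Sigma t /\ im_cone beta t = s i) t (conj St ts)).
  exists k, c, t; split=> [i|]; first by have [] := tE i.
  by apply: eq_bigr => i _; have [_ <-] := tE i; rewrite monE.
exists k, c, (fun i => im_cone beta (s i)); split=> [i|]; first by exists (s i).
by apply: eq_bigr => i _; rewrite monE.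
Qed.

End ImageStackyFan.

(** * Integer matrices *)

Lemma matrix_of_rows (K : Type) a b (P : 'I_a -> 'rV[K]_b -> Prop) :
  (forall i, exists v, P i v) -> exists M : 'M[K]_(a, b), forall i, P i (row i M).
Proof.
move=> /choice[v Pv]; exists (\matrix_i v i) => i.
by rewrite rowK.
Qed.

Lemma additive_mulmx_rows (N : zmodType) a b (g : {additive 'rV[int]_b -> N})
    (M : 'M[int]_(a, b)) v :
  g (v *m M) = \sum_i g (row i M) *~ v 0 i.
Proof.
rewrite mulmx_sum_row raddf_sum; apply: eq_bigr => i _.
by rewrite -[v 0 i in LHS]intz scaler_int raddfMz.
Qed.

Lemma lift_through_surjection (N' : zmodType) a b
    (g : {additive 'rV[int]_b -> N'}) (h : {additive 'rV[int]_a -> N'}) :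
  range g = setT -> exists T : 'M[int]_(a, b), forall v, g (v *m T) = h v.
Proof.
move=> gT; have [T TP] : exists T : 'M[int]_(a, b),
    forall i, g (row i T) = h (delta_mx 0 i).
  apply: (@matrix_of_rows _ _ _ (fun i v => g v = h (delta_mx 0 i))) => i.
  by have [v _ vE] : range g (h (delta_mx 0 i)); [rewrite gT | exists v].
exists T => v; rewrite additive_mulmx_rows [in RHS](row_sum_delta v) raddf_sum.
by apply: eq_bigr => i _; rewrite TP -[v 0 i in RHS]intz scaler_int raddfMz.
Qed.

(** If the subgroup im(A) of Z^b is saturated, then it is a direct summand, and A has
a generalized inverse.  In the Smith normal form A = L D V, saturation means that
each diagonal entry of D is 0, 1 or -1, whence D D^T D = D, so that
V^-1 D^T L^-1 is a generalized inverse. *)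
Lemma saturated_pseudo_inverse a b (A : 'M[int]_(a, b)) :
  (forall (k : int) (w : 'rV_b) (u : 'rV_a), k != 0 -> u *m A = k *: w ->
     exists u', w = u' *m A) ->
  exists X : 'M[int]_(b, a), A *m X *m A = A.
Proof.
move=> satA; have [L uL [V uV [d _ AE]]] := int_Smith_normal_form A.
set D := \matrix_(i, j) _ in AE.
have rowD (i : 'I_a) (j : 'I_b) : i = j :> nat -> row i D = d`_i *: delta_mx 0 j.
  by move=> ij; apply/rowP => l; rewrite !mxE eqxx /= -val_eqE /= mulr_natr ij eq_sym.
have rowDT (i : 'I_a) (j : 'I_b) :
    i = j :> nat -> row j D^T = d`_i *: delta_mx 0 i.
  move=> ij; apply/rowP => l; rewrite !mxE eqxx /= -val_eqE /= mulr_natr -ij.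
  by have [->|] := eqVneq (l : nat) i.
have d_unit (i : 'I_a) (j : 'I_b) : i = j :> nat -> d`_i * (d`_i * d`_i) = d`_i.
  move=> ij; have [->|d0] := eqVneq d`_i 0; first by rewrite mul0r.
  (* Row j of V is in im(A) by saturation, which makes d_i a divisor of 1. *)
  have /(satA _ _ _ d0)[u' u'E] :
      (row i (invmx L)) *m A = d`_i *: (delta_mx 0 j *m V).
    by rewrite AE -!row_mul !mulmxA mulVmx // mul1mx row_mul (rowD _ _ ij) scalemxAl.
  have : delta_mx 0 j = u' *m L *m D.
    by rewrite -[LHS](mulmxK uV) u'E AE !mulmxA mulmxK.
  move: (u' *m L) => p /matrixP/(_ 0 j); rewrite !mxE !eqxx /= (bigD1 i) //= big1 ?addr0.
    rewrite !mxE ij eqxx /= !mulr1n => e1.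
    have := intUnitRing.unitzPl (esym e1).
    by rewrite qualifE => /orP[]/eqP ->.
  move=> l li; rewrite !mxE (_ : (l == j :> nat) = false) ?mulr0n ?mulr0 //.
  by apply/negbTE; rewrite -ij; apply: contra li => /eqP/val_inj ->.
exists (invmx V *m D^T *m invmx L).
have DD : D *m D^T *m D = D.
  apply/row_matrixP => i; rewrite !row_mul.
  have [ib|ib] := ltnP i b; last first.
    suff -> : row i D = 0 by rewrite !mul0mx.
    apply/rowP => l; rewrite !mxE gtn_eqF ?mulr0n //.
    exact: leq_trans (ltn_ord l) ib.
  have ij : i = Ordinal ib :> nat by [].
  rewrite (rowD _ _ ij) -!scalemxAl -rowE (rowDT _ _ ij) -scalemxAl -rowE.
  by rewrite (rowD _ _ ij) !scalerA -mulrA (d_unit _ _ ij).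
by rewrite AE !mulmxA (mulmxK uV) (mulmxKV uL) -!mulmxA (mulmxA D) (mulmxA _ D) DD.
Qed.

(** Let M, T form a morphism from A0 : Z^a -> Z^p to A : Z^b -> Z^q which is an
isomorphism from ker(A0) to ker(A), where A0 is onto (with section L) and m kills
the cokernel of A (witness Z).  The two lemmas are about the map from
coker(A^T) to coker(A0^T) that M induces on the dual groups of column vectors. *)
Section DualQuotients.
Variables (a b p q m : nat).
Variables (A0 : 'M[int]_(a, p)) (A : 'M[int]_(b, q)).
Variables (M : 'M[int]_(a, b)) (T : 'M[int]_(p, q)).
Variables (L : 'M[int]_(p, a)) (Z : 'M[int]_(q, b)).
Hypothesis MA : M *m A = A0 *m T.
Hypothesis LA0 : L *m A0 = 1%:M.
Hypothesis ZA : Z *m A = (m%:Z)%:M.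
Hypothesis ker_lift : forall e : 'rV_b, e *m A = 0 ->
  exists2 e0, e0 *m A0 = 0 & e = e0 *m M.
Hypothesis ker_inj : forall e0 : 'rV_a, e0 *m A0 = 0 -> e0 *m M = 0 -> e0 = 0.

(** The pullback of y to Z^a vanishes on ker(A0), so y vanishes on ker(A).  The rows
of A Z - m lie in ker(A), whence m y = A (Z y). *)
Lemma dual_map_kernel_torsion (y : 'cV_b) (f : 'cV_p) :
  M *m y = A0 *m f -> y *+ m = A *m (Z *m y).
Proof.
move=> My; suff : (A *m Z - (m%:Z)%:M) *m y = 0.
  rewrite mulmxBl mul_scalar_mx -natz scaler_nat mulmxA.
  by move=> /eqP; rewrite subr_eq0 => /eqP ->.
apply/row_matrixP => i; rewrite row_mul row0.
have [|e0 e0A0 ->] := @ker_lift (row i (A *m Z - (m%:Z)%:M)).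
  by rewrite -row_mul mulmxBl -mulmxA ZA mul_mx_scalar mul_scalar_mx subrr row0.
by rewrite -mulmxA My mulmxA e0A0 mul0mx.
Qed.

(** P = 1 - A0 L projects Z^a onto ker(A0), so P M has image ker(A), which is
saturated.  If X is a generalized inverse of P M, then P M X P = P, which says that
M (X P c) and c are equal as functionals on ker(A0). *)
Lemma dual_map_section :
  exists Y : 'M[int]_(b, a), forall c : 'cV_a, exists f, M *m (Y *m c) - c = A0 *m f.
Proof.
pose P := 1%:M - A0 *m L.
have PA0 : P *m A0 = 0 by rewrite mulmxBl mul1mx -mulmxA LA0 mulmx1 subrr.
have kerP e0 : e0 *m A0 = 0 -> e0 *m P = e0 :> 'rV_a.
  by move=> e00; rewrite mulmxBr mulmx1 mulmxA e00 mul0mx subr0.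
have [|X PMX] := @saturated_pseudo_inverse _ _ (P *m M).
  move=> k w u k0 uw; have [|e0 e0A0 ->] := @ker_lift w.
    have : k *: (w *m A) = 0.
      by rewrite scalemxAl -uw -!mulmxA MA (mulmxA P) PA0 mul0mx mulmx0.
    by move/eqP; rewrite scalemx_eq0 (negPf k0) => /eqP.
  by exists e0; rewrite mulmxA kerP.
exists (X *m P) => c.
(* The rows of the difference lie in ker(A0), on which M is injective. *)
have PMXP : P *m M *m X *m P = P.
  apply/row_matrixP => i; apply/eqP; rewrite -subr_eq0 -raddfB /=; apply/eqP.
  apply: ker_inj; rewrite -row_mul mulmxBl.
    by rewrite -!mulmxA PA0 !mulmx0 subrr row0.
  by rewrite -[_ *m P *m M]mulmxA PMX subrr row0.
exists (L *m (M *m (X *m P *m c) - c)); set w := _ - c.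
have Pw : P *m w = 0 by rewrite mulmxBr !mulmxA PMXP subrr.
have := Pw; rewrite mulmxBl mul1mx mulmxA => /eqP.
by rewrite subr_eq0 => /eqP.
Qed.

End DualQuotients.

(** * The homomorphism DG(beta) -> DG(beta_0) *)

Section Resolution.
Variables (d n : nat) (N : zmodType) (beta : {additive 'rV[int]_n -> N}).
Variables (r : resolution_with_lift d beta).

Lemma factor_through_relations a (E : 'M[int]_(a, d + ell r)) :
  (forall v, resP r (v *m E) = 0) -> exists H, E = H *m resQ r.
Proof.
move=> E0; have [H HE] : exists H : 'M[int]_(a, ell r),
    forall i, row i E = row i H *m resQ r.
  apply: (@matrix_of_rows _ _ _ (fun i v => row i E = v *m resQ r)) => i.
  by have /res_exact[v vE] : resP r (row i E) = 0; [rewrite rowE | exists v].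
by exists H; apply/row_matrixP => i; rewrite row_mul HE.
Qed.

Lemma BQ_image w v :
  resP r w = beta v -> exists y, y *m BQ r = w.
Proof.
rewrite -(liftB_lift r) => wv.
have [u uE] : exists u, w - v *m liftB r = u *m resQ r.
  by apply/res_exact; rewrite raddfB wv subrr.
by exists (row_mx v u); rewrite mul_row_col -uE addrC subrK.
Qed.

Lemma matrix_through_BQ (m : nat) :
  (forall x, exists v, x *+ m = beta v) ->
  exists Z, Z *m BQ r = (m%:Z)%:M.
Proof.
move=> mN; have [Z ZE] : exists Z : 'M[int]_(d + ell r, n + ell r),
    forall i, row i Z *m BQ r = delta_mx 0 i *+ m.
  apply: (@matrix_of_rows _ _ _ (fun i y => y *m BQ r = delta_mx 0 i *+ m)) => i.
  have [v vE] := mN (resP r (delta_mx 0 i)).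
  by apply: (@BQ_image _ v); rewrite raddfMn.
exists Z; apply/row_matrixP => i; rewrite row_mul ZE.
by rewrite -scaler_nat natz rowE mul_mx_scalar.
Qed.

Lemma DG_piE x y :
  (\pi_(DG r) x = \pi_(DG r) y) <-> (exists f, x - y = BQ r *m f).
Proof.
split.
  move=> /eqP; rewrite -Quotient.idealrBE => /asboolP[f fE].
  by exists f.
by move=> xy; apply/eqP; rewrite -Quotient.idealrBE; apply/asboolP.
Qed.

End Resolution.

Section DGComparison.
Variables (d n : nat) (N : zmodType) (beta : {additive 'rV[int]_n -> N}).
Variables (r : resolution_with_lift d beta).
Variables (r0 : resolution_with_lift d (corestrict beta)).

Variable m : nat.
Hypothesis mN : forall x, x *+ m \in im_pred beta.

(** Composing with theta and with the set-theoretic section s is smooth on characters,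
since their smoothness is tested on values.  The embedding sigma of DG(beta_0) as a
direct summand of a free group writes its characters as monomials. *)
Lemma DG_restriction :
  exists theta : {additive DG r -> DG r0}, exists s : DG r0 -> DG r,
  exists sigma : {additive DG r0 -> 'cV[int]_(n + ell r0)},
    [/\ cancel s theta, cancel sigma \pi_(DG r0),
        forall x, theta x = 0 -> x *+ m = 0
      & forall f, theta (beta_dual r f) = beta_dual r0 f].
Proof.
pose incl : {additive _ -> N} := val \o resP r0.
have [T TE] := lift_through_surjection incl (resP_surj r).
have [S SE] : exists S, resQ r0 *m T = S *m resQ r.
  apply: factor_through_relations => v; rewrite mulmxA TE /=.
  by rewrite (_ : resP r0 _ = 0) ?raddf0 //; apply/res_exact; exists v.
have [H HE] : exists H, liftB r0 *m T - liftB r = H *m resQ r.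
  apply: factor_through_relations => v; rewrite mulmxBr raddfB mulmxA TE /=.
  by rewrite !liftB_lift subrr.
(* M lifts the inclusion of N_0 in N and is the identity on Z^n; the block H
   accounts for B_0 T and B being two lifts of beta. *)
pose M : 'M[int]_(n + ell r0, n + ell r) := block_mx 1%:M H 0 S.
have MA : M *m BQ r = BQ r0 *m T.
  by rewrite mul_block_col mul_col_mx mul1mx mul0mx add0r -SE -HE addrC subrK.
have [L LA0] : exists L, L *m BQ r0 = 1%:M.
  have [|L LE] := @matrix_through_BQ _ _ _ _ r0 1; last by exists L; rewrite LE.
  move=> x; have /asboolP[v _ vE] := valP x.
  by exists v; apply: val_inj; rewrite mulr1n /= vE.
have [Z ZA] : exists Z, Z *m BQ r = (m%:Z)%:M.
  apply: matrix_through_BQ => x; have /asboolP[v _ vE] := mN x.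
  by exists v.
have rowM v u : row_mx v u *m M = row_mx v (v *m H + u *m S).
  by rewrite mul_row_block mulmx1 mulmx0 addr0.
(* Both kernels are graphs over ker(beta), because Q and Q_0 are injective. *)
have ker_lift (e : 'rV[int]_(n + ell r)) : e *m BQ r = 0 ->
    exists2 e0, e0 *m BQ r0 = 0 & e = e0 *m M.
  rewrite -[e]hsubmxK; move: (lsubmx e) (rsubmx e) => v u {e}.
  rewrite mul_row_col => e0.
  have bv : corestrict beta v = 0.
    apply: val_inj => /=; rewrite -(liftB_lift r) -[RHS](raddf0 (resP r)).
    rewrite -e0 raddfD; rewrite [X in _ + X](_ : _ = 0) ?addr0 //.
    by apply/res_exact; exists u.
  have [u0 u0E] : exists u0, v *m liftB r0 = u0 *m resQ r0.
    by apply/res_exact; rewrite liftB_lift.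
  exists (row_mx v (- u0)); first by rewrite mul_row_col mulNmx u0E subrr.
  rewrite rowM; congr row_mx; apply: (resQ_inj (r := r)).
  rewrite mulmxDl -!mulmxA -HE -SE mulmxBr mulNmx !mulmxA u0E.
  by rewrite addrAC subrr add0r; apply/eqP; rewrite -addr_eq0 addrC e0.
have ker_inj (e0 : 'rV[int]_(n + ell r0)) : e0 *m BQ r0 = 0 -> e0 *m M = 0 -> e0 = 0.
  rewrite -[e0]hsubmxK; move: (lsubmx e0) (rsubmx e0) => v u {e0}.
  move=> + eM; have /eq_row_mx[v0 _] : row_mx v (v *m H + u *m S) = row_mx 0 0.
    by rewrite -rowM eM row_mx0.
  rewrite mul_row_col v0 mul0mx add0r -(mul0mx _ (resQ r0)).
  by move=> /(resQ_inj (r := r0)) ->; rewrite row_mx0.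
have [Y YE] := dual_map_section MA LA0 ker_lift ker_inj.
pose theta (x : DG r) : DG r0 := \pi_(DG r0) (M *m repr x).
have theta_pi y : theta (\pi_(DG r) y) = \pi_(DG r0) (M *m y).
  apply/DG_piE; have /DG_piE[f fE] := reprK (\pi_(DG r) y).
  by exists (T *m f); rewrite -mulmxBr fE !mulmxA MA.
have thetaB : zmod_morphism theta.
  move=> x y; rewrite -[x]reprK -[y]reprK -raddfB !theta_pi mulmxBr.
  by rewrite raddfB.
(* 1 - [B_0 Q_0] L kills the image of [B_0 Q_0], hence does not depend on the
   representative. *)
pose sigma (x : DG r0) : 'cV[int]_(n + ell r0) := repr x - BQ r0 *m (L *m repr x).
have sigma_pi y : sigma (\pi_(DG r0) y) = y - BQ r0 *m (L *m y).
  have /DG_piE[f fE] := reprK (\pi_(DG r0) y).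
  rewrite /sigma -(subrK y (repr _)) fE !mulmxDr !(mulmxA L) LA0 mul1mx.
  by rewrite opprD addrACA subrr add0r mulmxA.
have sigmaB : zmod_morphism sigma.
  move=> x y; rewrite -[x]reprK -[y]reprK -raddfB !sigma_pi !mulmxBr.
  by rewrite !opprD !opprK addrACA.
pose thetaA : {additive DG r -> DG r0} :=
  HB.pack theta (GRing.isZmodMorphism.Build _ _ theta thetaB).
pose sigmaA : {additive DG r0 -> 'cV[int]_(n + ell r0)} :=
  HB.pack sigma (GRing.isZmodMorphism.Build _ _ sigma sigmaB).
exists thetaA.
exists (fun x => \pi_(DG r) (Y *m repr x)).
exists sigmaA; split=> /=.
- by move=> x; rewrite theta_pi -[RHS]reprK; apply/DG_piE; exact: YE.
- move=> x; rewrite -[RHS]reprK; apply/DG_piE; exists (- (L *m repr x)).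
  by rewrite /sigma addrAC subrr add0r mulmxN.
- move=> x; rewrite -[x]reprK theta_pi -(raddf0 \pi_(DG r0)) => /DG_piE[f].
  rewrite subr0 => /(dual_map_kernel_torsion ZA ker_lift) E.
  rewrite -raddfMn -(raddf0 \pi_(DG r)); apply/DG_piE; exists (Z *m repr x).
  by rewrite subr0.
- move=> f; rewrite /beta_dual theta_pi mul_block_col mul1mx mul0mx !mulmx0.
  by rewrite !addr0.
Qed.

End DGComparison.

(** * Connectedness in spaces of characters *)

Lemma connected_finite_set1 (T : topologicalType) (A : set T) (x : T) :
  hausdorff_space T -> finite_set A -> connected A -> A x -> A = [set x].
Proof.
move=> /hausdorff_accessible/accessible_finite_set_closed closedF finA conA Ax.
apply/esym/conA; first by exists x.
  exists (~` (A `\ x)); first exact: closed_openC (closedF _ (finite_setD _ finA)).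
  apply/seteqP; split=> [_ ->|y [Ay]]; first by split=> // -[_ /(_ erefl)].
  by move=> nAy; apply: contrapT => yx; apply: nAy.
by exists [set x]; [exact: closedF (finite_set1 x) | apply/esym/setIidPr => _ ->].
Qed.

Lemma ptws_continuous (X K : topologicalType) (I : Type) (f : X -> {ptws I -> K}) :
  (forall i, continuous (fun x => f x i)) -> continuous f.
Proof.
move=> cf x; apply/cvg_sup => i; apply/cvg_image.
  by apply/seteqP; split=> // y _; exists (fun=> y).
move=> A fA; exists (fun g => A (g i)); first exact: cf.
by apply/seteqP; split=> [_ [g Ag <-]|y Ay]; [exact: Ag | exists (fun=> y)].
Qed.

Section ComplexPaths.
Variable R : realType.
Local Notation C := (Cx R).

Lemma finite_unity_roots m : (0 < m)%N -> finite_set [set z : C | z ^+ m = 1].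
Proof.
move=> m0; have [s sE] := closed_field_poly_normal ('X^m - 1 : {poly C}).
apply: (sub_finite_set _ (finite_seq s)) => z /= zm.
have : root ('X^m - 1) z by rewrite rootE !hornerE zm subrr.
rewrite sE rootZ ?root_prod_XsubC // lead_coef_eq0.
by rewrite -size_poly_eq0 size_XnsubC.
Qed.

Lemma real_complex_continuous : continuous (fun t : R => (t%:C)%C : C).
Proof.
move=> t; apply/cvgrPdist_lt => e; rewrite ltcE /= => /andP[/eqP e_real e0].
near=> s.
rewrite -rmorphB /= normc_def /= expr0n /= addr0 sqrtr_sqr ltcE /= e_real eqxx /=.
by near: s; apply: cvgr_dist_lt.
Unshelve. all: by end_near. Qed.

Definition clamp01 (t : R) : R := Num.max 0 (Num.min 1 t).

(** The square of the segment from 1 to the principal square root w of z.  The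
segment misses 0, because w is never a negative real number, whereas the segment
from 1 to z itself may meet 0.  Clamping the parameter makes the path defined and
nonzero on the whole real line. *)
Definition punctured_path (z : C) (t : R) : C :=
  (1 + ((clamp01 t)%:C)%C * (sqrtC z - 1)) ^+ 2.

Lemma punctured_path0 z : punctured_path z 0 = 1.
Proof.
by rewrite /punctured_path /clamp01 min_r // maxxx mul0r addr0 expr1n.
Qed.

Lemma punctured_path1 z : punctured_path z 1 = z.
Proof.
by rewrite /punctured_path /clamp01 minxx max_r // mul1r addrC subrK sqrtCK.
Qed.

(** If 1 + s (w - 1) = 0 with 0 < s <= 1, then w = 1 - 1/s <= 0. *)
Lemma punctured_path_neq0 z t : z != 0 -> punctured_path z t != 0.
Proof.
move=> z0; rewrite expf_neq0 //; set s := clamp01 t.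
have s0 : 0 <= s by rewrite le_max lexx.
have s1 : s <= 1 by rewrite ge_max ler01 ge_min lexx.
apply/eqP => e0.
have [sE|sn0] := eqVneq s 0; first by move: e0 => /eqP; rewrite sE mul0r addr0 oner_eq0.
have {sn0} s0' : 0 < s by rewrite lt_def sn0.
have sC0 : 0 < ((s%:C)%C : C) by rewrite ltcR.
have sC1 : ((s%:C)%C : C) <= 1 by rewrite -(rmorph1 (real_complex R)) lecR.
move: e0 sC0 sC1; rewrite -/s; move: ((s%:C)%C : C) => S e0 S0 S1.
have wE : sqrtC z = 1 - S^-1.
  apply: (mulfI (lt0r_neq0 S0)); rewrite mulrBr mulfV ?lt0r_neq0 // mulr1.
  by apply/eqP; rewrite -subr_eq0 -e0 mulrBr mulr1 opprB addrCA addrA.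
have : sqrtC z <= 0 by rewrite wE subr_le0 invf_ge1.
by rewrite sqrtC_le0 (negPf z0).
Qed.

Lemma punctured_path_continuous z : continuous (punctured_path z).
Proof.
have cC : continuous clamp01.
  move=> t; apply: continuous_max; first exact: cvg_cst.
  by apply: continuous_min; [exact: cvg_cst | exact: cvg_id].
have SC : continuous (fun t => ((clamp01 t)%:C)%C : C).
  move=> t; apply: continuous_comp; first exact: cC.
  exact: real_complex_continuous.
have wC : continuous (fun t => 1 + ((clamp01 t)%:C)%C * (sqrtC z - 1) : C).
  move=> t; apply: cvgD; first exact: cvg_cst.
  by apply: cvgM; [exact: SC | exact: cvg_cst].
by move=> t; apply: cvgM; exact: wC.
Qed.

Lemma continuous_exprz (X : topologicalType) (f : X -> C) (k : int) :
  continuous f -> (forall x, f x != 0) -> continuous (fun x => f x ^ k).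
Proof.
move=> cf f0; have cX j : continuous (fun x => f x ^+ j).
  elim: j => [|j IH] x; first by under eq_fun do rewrite expr0; exact: cvg_cst.
  by under eq_fun do rewrite exprS; apply: cvgM; [exact: cf | exact: IH].
case: k => j x; first exact: cX.
by apply: cvgV; [rewrite expf_neq0 | exact: cX].
Qed.

Lemma continuous_prod (X : topologicalType) (I : Type) (s : seq I)
    (f : I -> X -> C) :
  (forall i, continuous (f i)) -> continuous (fun x => \prod_(i <- s) f i x).
Proof.
move=> cf; elim: s => [|i s IH] x.
  by under eq_fun do rewrite big_nil; exact: cvg_cst.
by under eq_fun do rewrite big_cons; apply: cvgM; [exact: cf | exact: IH].
Qed.

End ComplexPaths.

Section Characters.
Variable R : realType.
Local Notation C := (Cx R).

Definition characters (D : zmodType) : set (D -> C) :=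
  [set chi | (forall x, chi x != 0) /\ (forall x y, chi (x + y) = chi x * chi y)].

Variable D : zmodType.
Implicit Type chi : D -> C.

Lemma character0 chi : characters chi -> chi 0 = 1.
Proof.
by move=> [chi0 chiD]; apply: (mulfI (chi0 0)); rewrite -chiD addr0 mulr1.
Qed.

Lemma characterN chi x : characters chi -> chi (- x) = (chi x)^-1.
Proof.
move=> chiP; have [chi0 chiD] := chiP.
by apply: (mulfI (chi0 x)); rewrite -chiD subrr character0 // mulfV.
Qed.

Lemma characterMn chi x m : characters chi -> chi (x *+ m) = chi x ^+ m.
Proof.
move=> chiP; elim: m => [|m IH]; first by rewrite mulr0n character0.
by rewrite mulrS exprS chiP.2 IH.
Qed.

Lemma characterMz chi x (k : int) : characters chi -> chi (x *~ k) = chi x ^ k.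
Proof.
move=> chiP; case: k => m; first exact: characterMn.
by rewrite NegzE mulrNz characterN // characterMn.
Qed.

Lemma character_sum chi (I : Type) (s : seq I) (F : I -> D) :
  characters chi -> chi (\sum_(i <- s) F i) = \prod_(i <- s) chi (F i).
Proof.
by move=> chiP; rewrite (big_morph chi chiP.2 (character0 chiP)).
Qed.

Definition character_component : set (D -> C) :=
  connected_component (@characters D : set {ptws D -> C}) (fun=> 1).

Lemma characters1 : @characters D (fun=> 1).
Proof. by split=> *; rewrite ?oner_eq0 ?mulr1. Qed.

(** Evaluation at x maps the component to a connected set of m-th roots of unity, and
there are finitely many of these. *)
Lemma character_component_torsion chi x m :
  (0 < m)%N -> x *+ m = 0 -> character_component chi -> chi x = 1.
Proof.
move=> m0 xm chi_comp; pose A : set {ptws D -> C} := character_component.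
pose ev (psi : {ptws D -> C}) : C := psi x.
have conA : connected (ev @` A).
  apply: connected_continuous_connected; first exact: component_connected.
  apply: continuous_subspaceT.
  exact: (@proj_continuous D (fun=> C : topologicalType) x).
have finA : finite_set (ev @` A).
  apply: sub_finite_set (finite_unity_roots R m0) => _ [psi psiA <-] /=.
  have psiP : characters psi := connected_component_sub psiA.
  by rewrite -characterMn // xm character0.
have A1 : (ev @` A) 1.
  by exists (fun=> 1) => //; apply: connected_component_refl; exact: characters1.
have -> // : [set (1 : C)] (chi x).
by rewrite -(connected_finite_set1 _ finA conA A1); [exists chi | exact: norm_hausdorff].
Qed.

(** Moving all the z i to 1 simultaneously in the punctured plane gives a path of
characters from chi to the trivial one. *)
Lemma torus_character_component a (tau : {additive D -> 'cV[int]_a})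
    (z : 'I_a -> C) chi :
  (forall i, z i != 0) -> (forall x, chi x = \prod_i z i ^ tau x i 0) ->
  character_component chi.
Proof.
move=> z0 chiE; pose p (t : R) : {ptws D -> C} :=
  fun x => \prod_i punctured_path (z i) t ^ tau x i 0.
have p_char t : characters (p t).
  split=> [x|x y]; rewrite /p.
    by apply/prodf_neq0 => i _; rewrite expfz_neq0 // punctured_path_neq0.
  rewrite -big_split; apply: eq_bigr => i _.
  by rewrite raddfD mxE expfzDr // punctured_path_neq0.
have p0 : p 0 = fun=> 1.
  by apply/funext => x; apply: big1 => i _; rewrite punctured_path0 exp1rz.
have p1 : p 1 = chi.
  by apply/funext => x; rewrite chiE; apply: eq_bigr => i _; rewrite punctured_path1.
exists (p @` `[0, 1]); last first.
  by exists 1 => //=; rewrite in_itv /= ler01 lexx.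
split.
- by exists 0 => //=; rewrite in_itv /= ler01 lexx.
- by move=> _ [t _ <-].
- apply: connected_continuous_connected; first exact: segment_connected.
  apply: continuous_subspaceT; apply: ptws_continuous => x.
  apply: continuous_prod => i; apply: continuous_exprz.
    exact: punctured_path_continuous.
  by move=> t; rewrite punctured_path_neq0.
Qed.

End Characters.

Lemma character_colE (R : realType) a (chi : 'cV[int]_a -> Cx R) y :
  characters chi -> chi y = \prod_i chi (delta_mx i 0) ^ y i 0.
Proof.
move=> chiP; rewrite [in LHS](matrix_sum_delta y) character_sum //.
apply: eq_bigr => i _.
by rewrite big_ord1 -[y i 0 in LHS]intz scaler_int characterMz.
Qed.

(** * Quotient stacks of isomorphic actions *)

Section GroupChange.
Variable R : realType.

(** An isomorphism of groups, both acting on Z.  The groups are subsets of ambient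
spaces on which nothing is assumed, so the compatibility of the inverse with units
and products is recorded as well; this makes the notion symmetric. *)
Record action_iso (K K' X : smooth_space R) (G : set K) (G' : set K')
    (one : K) (one' : K') (mul : K -> K -> K) (mul' : K' -> K' -> K')
    (Z : set X) (act : K -> X -> X) (act' : K' -> X -> X)
    (Phi : K -> K') (Psi : K' -> K) : Prop := ActionIso {
  aiso_diffeo : diffeomorphism G G' Phi Psi;
  aiso_one : Phi one = one';
  aiso_inv_one : Psi one' = one;
  aiso_mul : forall g h, G g -> G h -> Phi (mul g h) = mul' (Phi g) (Phi h);
  aiso_inv_mul : forall g h, G' g -> G' h -> Psi (mul' g h) = mul (Psi g) (Psi h);
  aiso_act : forall g z, G g -> Z z -> act' (Phi g) z = act g z }.

Lemma action_iso_sym K K' X G G' one one' mul mul' Z act act' Phi Psi :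
  @action_iso K K' X G G' one one' mul mul' Z act act' Phi Psi ->
  action_iso G' G one' one mul' mul Z act' act Psi Phi.
Proof.
case=> -[fG gG' sf sg] e e' M M' a; split=> //.
by move=> g z /gG'[G_g {2}<-] Zz; rewrite a.
Qed.

(** A principal G-bundle becomes a principal G'-bundle on the same total space by
letting G' act through Psi; trivializations are composed with Phi. *)
Section Transport.
Variables (K K' X : smooth_space R) (G : set K) (G' : set K').
Variables (one : K) (one' : K') (mul : K -> K -> K) (mul' : K' -> K' -> K').
Variables (Z : set X) (act : K -> X -> X) (act' : K' -> X -> X).
Variables (Phi : K -> K') (Psi : K' -> K).
Hypothesis iso : action_iso G G' one one' mul mul' Z act act' Phi Psi.

Local Notation Q := (SmoothAction G one mul Z act).
Local Notation Q' := (SmoothAction G' one' mul' Z act').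

Let PsiG g : G' g -> G (Psi g).
Proof. by have [_ + _ _] := aiso_diffeo iso => /[apply] -[]. Qed.
Let PsiK g : G' g -> Phi (Psi g) = g.
Proof. by have [_ + _ _] := aiso_diffeo iso => /[apply] -[]. Qed.
Let PhiG g : G g -> G' (Phi g).
Proof. by have [+ _ _ _] := aiso_diffeo iso => /[apply] -[]. Qed.
Let PhiK g : G g -> Psi (Phi g) = g.
Proof. by have [+ _ _ _] := aiso_diffeo iso => /[apply] -[]. Qed.

Section Object.
Variables (M : manifold R) (P : quotient_obj Q M).

Let bact' (g : K') (x : Defs.total P) : Defs.total P :=
  @bact R Q M P (Psi g) x.

Let bact_smooth' : @smooth_on R (prod_space K' (Defs.total P)) (Defs.total P)
  (G' `*` setT) (fun gx => bact' gx.1 gx.2).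
Proof.
move=> k U p oU pG [p1 p2].
apply: (@bact_smooth _ _ _ P k U (fun u => (Psi (p u).1, (p u).2)) oU).
  by move=> u /pG[G'p _]; split=> //=; exact: PsiG.
split=> //; have [_ _ _ sPsi] := aiso_diffeo iso.
by apply: (sPsi k U (fst \o p) oU) => // u /pG[].
Qed.

Let bmap_act' g x : G' g -> bmap (bact' g x) = act' g (bmap x).
Proof.
move=> G'g; rewrite /bact' bmap_act /=; last exact: PsiG.
by rewrite -(aiso_act iso) ?PsiK //; [exact: PsiG | exact: (bmap_spc (Q := Q))].
Qed.

Let btriv' (m : M) : exists (A : set M) (gamma : Defs.total P -> K')
    (psi : M * K' -> Defs.total P),
  [/\ dopen A, A m,
      @diffeomorphism R (Defs.total P) (prod_space M K')
        (@bproj _ _ _ P @^-1` A) (A `*` G') (fun x => (bproj x, gamma x)) psi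
    & forall g x, G' g -> A (bproj x) -> gamma (bact' g x) = mul' g (gamma x)].
Proof.
have [A [gamma [psi [oA Am [fA gA sf sg] gammaM]]]] := btriv P m.
have [_ _ sPhi sPsi] := aiso_diffeo iso.
have gammaG x : A (bproj x) -> G (gamma x) by move=> /fA[[]].
exists A, (Phi \o gamma), (fun y => psi (y.1, Psi y.2)); split=> //; first split.
- move=> x Ax; have [_ psiK] := fA x Ax.
  split; first by split=> //=; exact/PhiG/gammaG.
  by rewrite /= PhiK //; exact: gammaG.
- move=> [y g] [/= Ay G'g].
  have [Apsi] := gA (y, Psi g) (conj Ay (PsiG G'g)).
  by move=> [-> ->]; rewrite PsiK.
- move=> k U p oU pA sp; have [s1 s2] := sf k U p oU pA sp; split=> //.
  by apply: (sPhi k U (gamma \o p) oU) => // u /pA/gammaG.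
- move=> k U p oU pA [p1 p2].
  apply: (sg k U (fun u => ((p u).1, Psi (p u).2)) oU) => [u /pA[Ap G'p]|].
    by split=> //=; exact: PsiG.
  by split=> //; apply: (sPsi k U (snd \o p) oU) => // u /pA[].
- move=> g x G'g Ax /=.
  have Gg := PsiG G'g; have Gx := gammaG _ Ax.
  by rewrite gammaM // (aiso_mul iso) // PsiK.
Qed.

Definition transport_obj : quotient_obj Q' M.
Proof.
refine (@QuotientObj R Q' M (Defs.total P) (@bproj _ _ _ P) bact' (@bmap _ _ _ P)
  _ bact_smooth' _ _ _ btriv' _ _ bmap_act').
- exact: bproj_smooth.
- by move=> x; rewrite /bact' /= (aiso_inv_one iso); exact: (bact1 (Q := Q)).
- move=> g h x G'g G'h; rewrite /bact' /= (aiso_inv_mul iso) //.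
  by apply: (bactM (Q := Q)); exact: PsiG.
- by move=> g x G'g; apply: bproj_act; exact: PsiG.
- exact: (bmap_spc (Q := Q)).
- exact: bmap_smooth.
Defined.

End Object.

Section Morphism.
Variables (M M' : manifold R) (phi : smooth_map M M').
Variables (P : quotient_obj Q M) (P' : quotient_obj Q M').

Definition transport_hom (f : quotient_hom phi P P') :
  quotient_hom phi (transport_obj P) (transport_obj P').
Proof.
refine (@QuotientHom R Q' M M' phi (transport_obj P) (transport_obj P') f _ _ _ _).
- exact: (qhom_smooth f).
- by move=> g x G'g; apply: (qhom_act f); exact: PsiG.
- exact: (qhom_proj f).
- exact: (qhom_map f).
Defined.

Definition untransport_hom
    (f : quotient_hom phi (transport_obj P) (transport_obj P')) :
  quotient_hom phi P P'.
Proof.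
refine (@QuotientHom R Q M M' phi P P' f _ _ _ _).
- exact: (qhom_smooth f).
- move=> g x Gg; have := @qhom_act _ _ _ _ _ _ _ f (Phi g) x (PhiG Gg).
  by rewrite /= PhiK.
- exact: (qhom_proj f).
- exact: (qhom_map f).
Defined.

End Morphism.
End Transport.

(** The other fields of a morphism are proofs. *)
Lemma quotient_hom_eq (Q : smooth_action R) (M M' : manifold R)
    (phi : smooth_map M M') (P : quotient_obj Q M) (P' : quotient_obj Q M')
    (f g : quotient_hom phi P P') : qhom_fun f = qhom_fun g -> f = g.
Proof.
case: f => f sf af pf mf; case: g => g sg ag pg mg /= fg; case: _ / fg sg ag pg mg.
by move=> *; congr QuotientHom; exact: Prop_irrelevance.
Qed.

(** The functor keeps total spaces and underlying maps, hence is bijective on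
morphisms.  It is essentially surjective because transport back and forth changes
the action of g only to that of Phi (Psi g), which is g on the group. *)
Lemma action_iso_stack_equivalent K K' X G G' one one' mul mul' Z act act' Phi Psi :
  @action_iso K K' X G G' one one' mul mul' Z act act' Phi Psi ->
  stack_equivalent (SmoothAction G one mul Z act) (SmoothAction G' one' mul' Z act').
Proof.
move=> iso; have iso' := action_iso_sym iso.
exists (fun M P => transport_obj iso P).
exists (fun M M' phi P P' f => transport_hom iso f); split.
- by move=> M P; apply: quotient_hom_eq.
- by move=> *; apply: quotient_hom_eq.
- move=> M M' phi P P';
  exists (@untransport_hom _ _ _ _ _ _ _ _ _ _ _ _ _ _ iso _ _ phi P P').
    by move=> f; apply: quotient_hom_eq.
  by move=> f; apply: quotient_hom_eq.
- move=> M P'; exists (transport_obj iso' P').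
  have [_ PsiK _ _] := aiso_diffeo iso.
  pose Q' := SmoothAction G' one' mul' Z act'.
  pose T : quotient_obj Q' M := transport_obj iso (transport_obj iso' P').
  have bactE g (x : Defs.total P') : G' g -> @bact R Q' M T g x = @bact R Q' M P' g x.
    by move=> G'g /=; rewrite (PsiK _ G'g).2.
  have sf : @smooth_on R (Defs.total T) (Defs.total P') setT idfun by move=> k U p.
  have sg : @smooth_on R (Defs.total P') (Defs.total T) setT idfun by move=> k U p.
  exists (@QuotientHom R Q' M M (smap_id M) T P' idfun sf bactE
    (fun=> erefl) (fun=> erefl)).
  exists (@QuotientHom R Q' M M (smap_id M) P' T idfun sg
    (fun g x G'g => esym (bactE g x G'g)) (fun=> erefl) (fun=> erefl)).
  by split.
Qed.

End GroupChange.

(** * The identity component of G *)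

Section CharacterGroups.
Variables (R : realType) (d n : nat) (N : zmodType).
Variables (beta : {additive 'rV[int]_n -> N}).
Variables (r : resolution_with_lift d beta).
Variables (r0 : resolution_with_lift d (corestrict beta)).

(** The isomorphism is chi |-> chi \o theta, with inverse chi |-> chi \o s.  For chi in
the identity component, chi \o s is multiplicative although s is not, because chi
is trivial on the torsion group ker(theta). *)
Lemma identity_component_iso m (Z : set (complex_space R n)) :
  (0 < m)%N -> (forall x, x *+ m \in im_pred beta) ->
  exists (Phi : char_space R r0 -> char_space R r)
         (Psi : char_space R r -> char_space R r0),
    action_iso (torus_hom R r0) (identity_component R r)
      (@char_one R d n _ _ r0) (@char_one R d n _ _ r)
      (@char_mul R d n _ _ r0) (@char_mul R d n _ _ r)
      Z torus_action torus_action Phi Psi.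
Proof.
move=> m0 mN.
have [theta [s [sigma [thetaK sigmaK ker_torsion theta_beta]]]] :=
  DG_restriction r r0 mN.
exists (fun chi => chi \o theta), (fun chi => chi \o s).
have comp_char (chi : char_space R r) :
    identity_component R r chi -> torus_hom R r chi.
  by apply: connected_component_sub.
have comp_fiber (chi : char_space R r) x y :
    identity_component R r chi -> theta x = theta y -> chi x = chi y.
  move=> chi_comp xy; have chiP := comp_char _ chi_comp.
  rewrite -(subrK y x) chiP.2 (@character_component_torsion R _ chi _ m) ?mul1r //.
  by apply: ker_torsion; rewrite raddfB xy subrr.
split=> //; last first.
  move=> chi z _ _; apply/rowP => j; rewrite !mxE /=.
  by rewrite -theta_beta.
split.
- move=> chi chiP; split; last first.
    by apply/funext => x /=; rewrite thetaK.
  (* sigma \o theta makes chi \o theta a monomial in the values of chi on a basis. *)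
  pose X (y : 'cV[int]_(n + ell r0)) : Cx R := chi (\pi_(DG r0) y).
  have XP : characters X.
    by split=> [y|y z]; rewrite /X ?raddfD; [exact: chiP.1 | exact: chiP.2].
  apply: (@torus_character_component R _ _ (sigma \o theta)
    (fun i => X (delta_mx i 0))) => [i|x]; first exact: XP.1.
  by rewrite -character_colE // /X /= sigmaK.
- move=> chi chi_comp; have chiP := comp_char _ chi_comp; split; last first.
    by apply/funext => x /=; apply: comp_fiber; rewrite // thetaK.
  split=> [x|x y] /=; first exact: chiP.1.
  by rewrite -chiP.2; apply: comp_fiber; rewrite // raddfD !thetaK.
- by move=> k U p oU pG sp x; exact: sp.
- by move=> k U p oU pG sp x; exact: sp.
Qed.

End CharacterGroups.

(** * The stacky fan of the image and its stack *)

Theorem proposition2p11 (R : realType) (d n : nat) (N : zmodType)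
    (Sigma : set (set (realification R N)))
    (rho : 'I_n -> set (realification R N))
    (beta : {additive 'rV[int]_n -> N}) :
  stacky_fan d Sigma rho beta ->
  bijective (im_realification R beta) /\
  stacky_fan d (im_fan beta Sigma) (fun j => im_cone beta (rho j)) (corestrict beta) /\
  forall (r : resolution_with_lift d beta)
         (r0 : resolution_with_lift d (corestrict beta)),
    cox_open_set (im_fan beta Sigma) (fun j => im_cone beta (rho j)) =
      cox_open_set Sigma rho /\
    (exists (Phi : char_space R r0 -> char_space R r)
            (Psi : char_space R r -> char_space R r0),
      [/\ diffeomorphism (torus_hom R r0) (identity_component R r) Phi Psi,
          forall chi chi', torus_hom R r0 chi -> torus_hom R r0 chi' ->
            Phi (char_mul chi chi') = char_mul (Phi chi) (Phi chi')
        & forall chi z, torus_hom R r0 chi -> cox_open_set Sigma rho z ->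
            torus_action (Phi chi) z = torus_action chi z]) /\
    stack_equivalent
      (toric_stack r0 (im_fan beta Sigma) (fun j => im_cone beta (rho j)))
      (torus_quotient R r (identity_component R r) (cox_open_set Sigma rho)).
Proof.
move=> fan; have [m m0 mN] := stacky_fan_finite_index fan.
split; first exact: im_realification_bij mN m0.
split; first exact: stacky_fan_im.
move=> r r0; have coxE := cox_open_set_im fan.
have [Phi [Psi iso]] := identity_component_iso r r0 (cox_open_set Sigma rho) m0 mN.
split=> //; split.
  exists Phi, Psi; split.
  - exact: aiso_diffeo iso.
  - exact: aiso_mul iso.
  - exact: aiso_act iso.
rewrite /toric_stack coxE; exact: action_iso_stack_equivalent iso.
Qed.
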